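(* Let $\mathbf{k}$ be an algebraically closed field of characteristic different from $2$ and $3$, let $\tau$ be a positive integer, let $\mathcal{H}=\langle 6,2+6\tau,3+6\tau,4+6\tau,5+6\tau\rangle$, and let $\mathcal{Q}_{\mathcal{H}}$ be the quadratic quasi-cone of $\mathcal{H}$ (see context). Then $$\dim\mathcal{Q}_{\mathcal{H}}=8\tau+6.$$
   Context: Definition of $\mathcal{Q}_{\mathcal{H}}$. Consider unknown coefficients $g_{ir}$, $f_{ir}$ of weight $r$, arranged as polynomials in one variable $t$: for each residue $j\in\{1,\dots,6\}$, the partial polynomial $g_i^{(j)}=\sum_{r\equiv j\bmod 6}g_{ir}t^r$ (similarly $f_i^{(j)}$), where $r$ runs over the positive integers $\equiv j \bmod 6$ not larger than the formal degree of the partial polynomial. Put $$\begin{aligned} g_4&=g_4^{(1)}+g_4^{(2)}+g_4^{(4)}+g_4^{(5)}+g_4^{(6)}, & f_6&=f_6^{(1)}+f_6^{(3)}+f_6^{(4)}+f_6^{(6)},\\ g_5&=g_5^{(1)}+g_5^{(2)}+g_5^{(3)}+g_5^{(5)}+g_5^{(6)}, & f_8&=f_8^{(2)}+f_8^{(4)}+f_8^{(5)}+f_8^{(6)},\\ g_6&=g_6^{(1)}+g_6^{(2)}+g_6^{(3)}+g_6^{(4)}+g_6^{(6)}, & f_9&=f_9^{(1)}+f_9^{(3)}+f_9^{(6)},\\ g_7&=g_7^{(1)}+g_7^{(2)}+g_7^{(3)}+g_7^{(4)}+g_7^{(5)}, & f_{10}&=f_{10}^{(1)}+f_{10}^{(2)}+f_{10}^{(4)}+f_{10}^{(5)}+f_{10}^{(6)},\\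 g_8&=g_8^{(2)}+g_8^{(3)}+g_8^{(4)}+g_8^{(5)}+g_8^{(6)}. \end{aligned}$$ Formal degrees: $g_4^{(4)},g_5^{(5)},g_6^{(6)},f_6^{(6)},g_7^{(1)},g_8^{(2)},f_8^{(2)},f_9^{(3)},f_{10}^{(4)}$ have formal degree $i+12\tau$ ($i$ the lower index); $g_4^{(5)},g_4^{(6)},g_5^{(6)}$ have formal degree $j+6(\tau-1)$; $f_9^{(1)},f_{10}^{(1)},f_{10}^{(2)}$ have formal degree $j+6(\tau+1)$; the remaining 26 partial polynomials have formal degree $j+6\tau$. Moreover $g_{41}=g_{42}=g_{46}=0$. This leaves $50\tau+43$ unknown coefficients, subject to the following five polynomial identities in $t$: $$\begin{aligned} g_4-f_6+g_8&=f_6^{(1)}f_9+f_6^{(3)}g_7+(f_6^{(4)}-g_8^{(4)})f_6-g_8^{(5)}g_5-g_8^{(6)}g_4,\\ g_5-f_6+f_9&=f_6^{(1)}f_{10}+f_6^{(3)}f_8-f_9^{(6)}g_5-f_9^{(1)}g_4,\\ g_6-f_6-f_8+f_9&=f_8^{(4)}g_8+f_8^{(5)}g_7-f_9^{(6)}g_6+f_8^{(6)}f_6-f_9^{(1)}g_5,\\ g_7-f_8+f_{10}&=f_8^{(4)}f_9+(f_8^{(5)}-f_{10}^{(5)})f_8-f_{10}^{(6)}g_7-f_{10}^{(1)}g_6-f_{10}^{(2)}g_5,\\ g_8-f_8-f_9+f_{10}&=f_9^{(6)}f_8-f_{10}^{(5)}f_9-f_{10}^{(6)}g_8-f_{10}^{(1)}g_7-f_{10}^{(2)}f_6.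 \end{aligned}$$ Comparing coefficients of powers of $t$ gives a system of quasi-homogeneous polynomial equations $\varrho_j=0$ in the $50\tau+43$ coefficients, where $\varrho_j=\varrho_j^{(1)}+\varrho_j^{(2)}$ (linear plus quadratic part). Let $\mathcal{T}_{\mathcal{H}}$ be the weighted vector space defined by the linear equations $\varrho_j^{(1)}=0$ for all $j$. Solve these linear equations for as many coefficients as possible in terms of the remaining ones, which become coordinates on $\mathcal{T}_{\mathcal{H}}$; by quasi-homogeneity the same coefficients can be eliminated from as many of the polynomial equations $\varrho_j=0$, and substituting into the other equations one gets quasi-homogeneous polynomials $h_j$ on $\mathcal{T}_{\mathcal{H}}$ without linear terms. Then $\mathcal{Q}_{\mathcal{H}}\subseteq\mathcal{T}_{\mathcal{H}}$ is the common zero locus of the homogeneous components $h_j^{(2)}$ of degree 2 of the $h_j$. *)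

(* Defs.v *)
From HB Require Import structures.
From mathcomp Require Import all_boot all_order all_algebra.
From mathcomp Require Import mpoly.

Set Implicit Arguments.
Unset Strict Implicit.
Unset Printing Implicit Defensive.

Import GRing.Theory.
Local Open Scope ring_scope.

Section AffineSpace.
Variables (k : fieldType) (n : nat).

Definition affine_set := 'rV[k]_n -> Prop.

Definition zero_locus (S : {mpoly k[n]} -> Prop) : affine_set :=
  fun x => forall p, S p -> p.@[x 0] = 0.

Definition subset_aff (A B : affine_set) : Prop := forall x, A x -> B x.

Definition zclosed (A : affine_set) : Prop :=
  exists S, forall x, A x <-> zero_locus S x.

Definition zirreducible (A : affine_set) : Prop :=
  (exists x, A x) /\
  forall B C, zclosed B -> zclosed C ->
    subset_aff A (fun x => B x \/ C x) -> subset_aff A B \/ subset_aff A C.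

(* [Z 0 < Z 1 < ... < Z d] is a strict chain of irreducible closed subsets of
   [V]; closedness is taken in the ambient space, which for closed [V] agrees
   with closedness in [V]. *)
Definition irreducible_chain (V : affine_set) (d : nat)
    (Z : nat -> affine_set) : Prop :=
  (forall i, (i <= d)%N ->
     [/\ zclosed (Z i), zirreducible (Z i) & subset_aff (Z i) V]) /\
  (forall i, (i < d)%N ->
     subset_aff (Z i) (Z i.+1) /\ ~ subset_aff (Z i.+1) (Z i)).

(* Krull dimension for the Zariski topology. *)
Definition has_dim (V : affine_set) (d : nat) : Prop :=
  (exists Z, irreducible_chain V d Z) /\
  (forall e Z, irreducible_chain V e Z -> (e <= d)%N).

End AffineSpace.

(* The letters g and f of the coefficients g_{ir}, f_{ir}. *)
Definition G : bool := true.
Definition F : bool := false.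

(* Residues j for which the partial polynomial of letter [a] and lower index
   [i] exists; residues are taken in {1,...,6}. *)
Definition residues (a : bool) (i : nat) : seq nat :=
  if a then
    match i with
    | 4 => [:: 1; 2; 4; 5; 6]
    | 5 => [:: 1; 2; 3; 5; 6]
    | 6 => [:: 1; 2; 3; 4; 6]
    | 7 => [:: 1; 2; 3; 4; 5]
    | 8 => [:: 2; 3; 4; 5; 6]
    | _ => [::]
    end%N
  else
    match i with
    | 6 => [:: 1; 3; 4; 6]
    | 8 => [:: 2; 4; 5; 6]
    | 9 => [:: 1; 3; 6]
    | 10 => [:: 1; 2; 4; 5; 6]
    | _ => [::]
    end%N.

(* [fdeg tau a i j] is the formal degree of g_i^(j) or f_i^(j). *)
Definition fdeg (tau : nat) (a : bool) (i j : nat) : nat :=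
  if a then
    match i, j with
    | 4, 4 | 5, 5 | 6, 6 | 7, 1 | 8, 2 => i + 12 * tau
    | 4, 5 | 4, 6 | 5, 6 => j + 6 * (tau - 1)
    | _, _ => j + 6 * tau
    end%N
  else
    match i, j with
    | 6, 6 | 8, 2 | 9, 3 | 10, 4 => i + 12 * tau
    | 9, 1 | 10, 1 | 10, 2 => j + 6 * (tau + 1)
    | _, _ => j + 6 * tau
    end%N.

(* g_{41} = g_{42} = g_{46} = 0 *)
Definition normalized (a : bool) (i r : nat) : bool :=
  [&& a, i == 4 & r \in [:: 1; 2; 6]]%N.

(* [(a, i, r)] stands for the coefficient g_{ir} or f_{ir}. *)
Definition is_unknown (tau : nat) (c : bool * nat * nat) : bool :=
  let: (a, i, r) := c in
  [&& (0 < r)%N, ~~ normalized a i r &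
      has (fun j => (r == j %[mod 6]) && (r <= fdeg tau a i j)%N)
          (residues a i)].

(* The bounds 11 and 12 tau + 11 exceed every lower index and every formal
   degree, so all the unknowns are listed, each once. *)
Definition unknowns (tau : nat) : seq (bool * nat * nat) :=
  [seq c <- [seq (ai, r) | ai <- [seq (a, i) | a <- [:: G; F], i <- iota 0 11],
                           r <- iota 0 (12 * tau + 11)]
     | is_unknown tau c].

Definition nunk (tau : nat) : nat := size (unknowns tau).

Section Equations.
Variables (k : fieldType) (tau : nat).
Local Notation n := (nunk tau).

Definition partial_poly (a : bool) (i j : nat) : {poly {mpoly k[n]}} :=
  \sum_(u < n | let: (b, l, r) := tnth (in_tuple (unknowns tau)) u in
                [&& b == a, l == i & r == j %[mod 6]])
    ('X_u)%:P * 'X^((tnth (in_tuple (unknowns tau)) u).2).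

Definition full_poly (a : bool) (i : nat) : {poly {mpoly k[n]}} :=
  \sum_(j <- residues a i) partial_poly a i j.

Local Notation g i := (full_poly G i%N).
Local Notation f i := (full_poly F i%N).
Local Notation gp i j := (partial_poly G i%N j%N).
Local Notation fp i j := (partial_poly F i%N j%N).

Definition identities : seq {poly {mpoly k[n]}} :=
  [:: (g 4 - f 6 + g 8)
      - (fp 6 1 * f 9 + fp 6 3 * g 7 + (fp 6 4 - gp 8 4) * f 6
         - gp 8 5 * g 5 - gp 8 6 * g 4);
      (g 5 - f 6 + f 9)
      - (fp 6 1 * f 10 + fp 6 3 * f 8 - fp 9 6 * g 5 - fp 9 1 * g 4);
      (g 6 - f 6 - f 8 + f 9)
      - (fp 8 4 * g 8 + fp 8 5 * g 7 - fp 9 6 * g 6 + fp 8 6 * f 6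
         - fp 9 1 * g 5);
      (g 7 - f 8 + f 10)
      - (fp 8 4 * f 9 + (fp 8 5 - fp 10 5) * f 8 - fp 10 6 * g 7
         - fp 10 1 * g 6 - fp 10 2 * g 5);
      (g 8 - f 8 - f 9 + f 10)
      - (fp 9 6 * f 8 - fp 10 5 * f 9 - fp 10 6 * g 8 - fp 10 1 * g 7
         - fp 10 2 * f 6)].

(* [(e, m)] indexes the coefficient of t^m in the e-th identity. *)
Definition eqn_index : Type := ('I_5 * nat)%type.

Definition rho (j : eqn_index) : {mpoly k[n]} := (nth 0 identities j.1)`_(j.2).

Definition T_H : affine_set k n :=
  fun x => forall j, (pihomog mdeg 1 (rho j)).@[x 0] = 0.

(* Solving for the coefficients in [E] by means of the equations in [B]:
   - the coefficients outside [E] are coordinates on [T_H];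
   - [B] consists of #|E| equations whose linear parts already define [T_H];
   - [s] expresses every coefficient polynomially in terms of those outside [E]
     and turns the equations in [B] into identities.
   All unknowns have positive weight and each [rho j] is quasi-homogeneous, so
   [s] is determined by [E] and [B], by induction on the weight. *)
Definition is_elimination (E : {set 'I_n}) (B : seq eqn_index)
    (s : n.-tuple {mpoly k[n]}) : Prop :=
  [/\ forall y : 'rV[k]_n, exists! x,
        T_H x /\ forall u, u \notin E -> x 0 u = y 0 u,
      uniq B /\ size B = #|E|,
      forall x : 'rV[k]_n,
        (forall j, j \in B -> (pihomog mdeg 1 (rho j)).@[x 0] = 0) -> T_H x,
      (forall u, u \notin E -> tnth s u = 'X_u) /\
      (forall u m, m \in msupp (tnth s u) -> forall v, v \in E -> m v = 0%N)
    & forall j, j \in B -> rho j \mPo s = 0].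

(* The quadratic quasi-cone of <6, 2+6tau, 3+6tau, 4+6tau, 5+6tau>, as a subset
   of the ambient space of all the coefficients. The polynomials
   h_j = rho j \mPo s only involve the coordinates of [T_H], so evaluating them
   at a point of [T_H] is unambiguous; those with [j] in [B] are zero. *)
Definition Q_H (s : n.-tuple {mpoly k[n]}) : affine_set k n :=
  fun x => T_H x /\ forall j, (pihomog mdeg 2 (rho j \mPo s)).@[x 0] = 0.

End Equations.

(* Main.v *)
Require Import Defs.
From HB Require Import structures.
From mathcomp Require Import all_boot all_order all_algebra.
From mathcomp Require Import mpoly.
From mathcomp Require Import ring zify.
From Stdlib Require Import Classical.
Import GRing.Theory.
Local Open Scope ring_scope.

Set Implicit Arguments.
Unset Strict Implicit.
Unset Printing Implicit Defensive.

(* Whatever elimination is used, the quadratic quasi-cone is the set of tangent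
   vectors [x] in [T_H] that extend to second order, i.e. such that the linear parts
   of the equations take, at some point [y], the values of the quadratic parts at [x].
   Splitting the polynomials according to the residue of the exponents mod 6, a point of
   [T_H] amounts to eleven polynomials in [T = t^6], and solvability for [y] to a bound
   on the degrees of five quadratic expressions in ten of them. These are the
   Pluecker relations of Gr(2,5): read from the top coefficient downwards, they define
   the jets of order [tau - 1] of the 7-dimensional affine cone over Gr(2,5). The
   remaining tau + 6 coefficients are free.

   The bound from above stratifies the jets by their order: where the leading
   coefficient of some coordinate is invertible, the three complementary coordinates
   are determined by the others up to the order of the jet. A chain of length [e] of
   irreducible sets yields [M ^ e] linearly independent polynomials of degree [O(M)] on
   its largest member, which is incompatible with fewer than [e] generators of the
   localized coordinate ring. The bound from below takes the closures of the images of
   a flag of coordinate subspaces under a polynomial parametrization. *)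

(** * Krull dimension *)

(** The degree bounds on the quadrics concern the coefficients of T^(tau+1), ..., T^(2 tau), which
    never involve constant terms; hence jets with tau coefficients. Of the ten constant terms, those
    of a1 and d2 vanish by the normalization and that of the shifted a5 by construction, so 7 are
    free; c6 has tau - 1 free coefficients, its two extreme ones being those of -v. This gives tau +
    6. A chart of the 7-dimensional cone gives 7 tau more. Irreducibility of the jet space is never
    established: on a stratum of order o, the jets need at most 7 (tau - o) + 3 o = 7 tau - 4 o
    generators after localization, so deeper strata are not larger. As dimension is defined by
    chains alone, the upper bound has to treat an arbitrary chain. Counting independent functions by
    degree plays the part of the transcendence degree, and irreducibility of the largest member
    allows one function that is not identically zero on it to be inverted. *)

Section DegreeBound.
Variables (k : fieldType) (n : nat).
Implicit Types p q : {mpoly k[n]}.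

Lemma msizeM_leS p q a b :
  (msize p <= a.+1)%N -> (msize q <= b.+1)%N -> (msize (p * q) <= (a + b).+1)%N.
Proof.
have [->|p0] := eqVneq p 0; first by rewrite mul0r msize0.
have [->|q0] := eqVneq q 0; first by rewrite mulr0 msize0.
by move=> ha hb; rewrite msizeM //; move: (msize p) (msize q) ha hb => s t; lia.
Qed.

Lemma msizeX_leS p a e : (msize p <= a.+1)%N -> (msize (p ^+ e) <= (e * a).+1)%N.
Proof.
move=> ha; elim: e => [|e IH]; first by rewrite expr0 msize1.
by rewrite exprS mulSn msizeM_leS.
Qed.

Lemma msize_prod_leS (I : Type) (r : seq I) (F : I -> {mpoly k[n]}) (a : I -> nat) :
  (forall i, (msize (F i) <= (a i).+1)%N) ->
  (msize (\prod_(i <- r) F i) <= (\sum_(i <- r) a i).+1)%N.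
Proof.
move=> ha; elim: r => [|i r IH]; first by rewrite !big_nil msize1.
by rewrite !big_cons msizeM_leS.
Qed.

Lemma msize_sum_le (I : Type) (r : seq I) (F : I -> {mpoly k[n]}) a :
  (forall i, (msize (F i) <= a)%N) -> (msize (\sum_(i <- r) F i) <= a)%N.
Proof.
move=> ha; elim: r => [|i r IH]; first by rewrite big_nil msize0.
by rewrite big_cons (leq_trans (msizeD_le _ _)) // geq_max ha.
Qed.

End DegreeBound.

(** * Independent functions along a chain of irreducible closed sets *)

Section UpperBound.
Variables (k : fieldType) (n : nat).
Implicit Types (A B : affine_set k n) (p q : {mpoly k[n]}).

Lemma zirreducible_mul A p q : zirreducible A ->
  (forall x, A x -> p.@[x 0] * q.@[x 0] = 0) ->
  (forall x, A x -> p.@[x 0] = 0) \/ (forall x, A x -> q.@[x 0] = 0).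
Proof.
case=> _ irrA pq.
have zc r : zclosed (fun x : 'rV[k]_n => r.@[x 0] = 0).
  exists (eq r) => x; split=> [rx _ <- //|]; exact.
case: (irrA _ _ (zc p) (zc q)) => [x Ax||]; [|by left|by right].
by move/eqP: (pq x Ax); rewrite mulf_eq0 => /orP[]/eqP; [left|right].
Qed.

Lemma zirreducible_exp A p e : zirreducible A ->
  (forall x, A x -> p.@[x 0] ^+ e = 0) -> forall x, A x -> p.@[x 0] = 0.
Proof.
move=> irrA; elim: e => [|e IH] pe.
  by case: irrA => -[x Ax] _; move/eqP: (pe x Ax); rewrite oner_eq0.
case: (@zirreducible_mul A p (p ^+ e) irrA) => // [x Ax|].
  by rewrite rmorphXn -exprS pe.
by move=> h; apply: IH => x /h; rewrite rmorphXn.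
Qed.

(** Independence of the restrictions to [A], that is, in the coordinate ring of [A]. *)
Definition lin_indep_on A (I : finType) (F : I -> {mpoly k[n]}) : Prop :=
  forall c : I -> k,
    (forall x, A x -> \sum_i c i * (F i).@[x 0] = 0) -> forall i, c i = 0.

Lemma zclosed_separate A B : zclosed A -> ~ subset_aff B A ->
  exists p, (forall x, A x -> p.@[x 0] = 0) /\ ~ (forall x, B x -> p.@[x 0] = 0).
Proof.
case=> S AS nBA; apply: NNPP => nex; apply: nBA => x Bx; apply/AS => p Sp.
apply: NNPP => px; apply: nex; exists p; split; last by move/(_ x Bx).
by move=> y /AS; apply.
Qed.

(* A polynomial vanishing on the smaller set but not on the larger one is
   transcendental over any functions that stay independent on the smaller one. *)
Lemma lin_indep_powers A B f (I : finType) (F : I -> {mpoly k[n]}) M :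
  zirreducible B -> subset_aff A B -> (forall x, A x -> f.@[x 0] = 0) ->
  ~ (forall x, B x -> f.@[x 0] = 0) -> lin_indep_on A F ->
  lin_indep_on B (fun ai : 'I_M * I => f ^+ ai.1 * F ai.2).
Proof.
move=> irrB AB fA fB indF c c0.
suff cz a : forall (i : I) (b : 'I_M), b = a :> nat -> c (b, i) = 0.
  by case=> b i; apply: (cz b).
elim/ltn_ind: a => a IH i b ba.
(* The coefficients of powers below [a] are already zero, so the relation on [B] is [f ^+ a] times
   [g]. Irreducibility of [B] gives [g = 0] there; restricted to [A], where [f] vanishes, only the
   terms of power exactly [a] survive. *)
pose g : {mpoly k[n]} :=
  \sum_(u : 'I_M * I | (a <= u.1)%N) c u *: (f ^+ (u.1 - a) * F u.2).
have gB x : B x -> (f ^+ a).@[x 0] * g.@[x 0] = 0.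
  move=> Bx; apply: etrans (c0 x Bx); rewrite -mevalM mulr_sumr raddf_sum /=.
  rewrite [RHS](bigID (fun u : 'I_M * I => a <= u.1)%N) /=.
  rewrite [X in _ = _ + X]big1 => [|[u v] /=]; last first.
    by rewrite -ltnNge => ua; rewrite (IH u) // mul0r.
  rewrite addr0; apply: eq_bigr => u au.
  by rewrite -scalerAr mevalZ mulrA -exprD subnKC.
case: (zirreducible_mul irrB gB) => [fa|g0].
  by case: fB; apply: (@zirreducible_exp _ _ a irrB) => x /fa; rewrite rmorphXn.
apply: (indF (fun i => c (b, i))) => x Ax.
apply: etrans (g0 x (AB x Ax)); rewrite raddf_sum /=.
pose t u v := (c (u, v) *: (f ^+ (u - a) * F v)).@[x 0].
transitivity (\sum_(u < M | (a <= u)%N) \sum_v t u v); last first.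
  by rewrite pair_big_dep; apply: eq_big => -[u v] //=; rewrite andbT.
rewrite (bigD1 b) ?ba //= [X in _ = _ + X]big1 ?addr0 => [|u /andP[au ub]].
  by apply: eq_bigr => v _; rewrite /t ba subnn expr0 mul1r mevalZ.
apply: big1 => v _; rewrite /t mevalZ mevalM rmorphXn /= fA // expr0n.
have -> : (u - a == 0)%N = false by apply/negbTE; move: ub; rewrite -val_eqE /=; lia.
by rewrite mul0r mulr0.
Qed.

(** Each step up the chain supplies a new function [f]; its first [M] powers multiply the number of
    independent functions by [M] and add at most [M * msize f] to the degree. The constant [C] does
    not depend on [M]. *)
Lemma irreducible_chain_indep V e (Z : nat -> affine_set k n) : irreducible_chain V e Z ->
  forall i, (i <= e)%N -> exists C, forall M, exists (I : finType) F,
    [/\ #|I| = (M ^ i)%N, forall j : I, (msize (F j) <= (C * M).+1)%N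
      & lin_indep_on (Z i) F].
Proof.
case=> irrZ ltZ; elim=> [|i IH] ie.
  exists 0 => M; exists 'I_1, (fun=> 1); split=> [||c c0 i0].
  - by rewrite card_ord.
  - by move=> _; rewrite msize1.
  have [_ [[x Zx] _] _] := irrZ 0 (leq0n e).
  by move: (c0 x Zx); rewrite big_ord1 meval1 mulr1 (ord1 i0).
have [C HC] := IH (ltnW ie).
have [zi _ _] := irrZ i (ltnW ie); have [_ irr' _] := irrZ i.+1 ie.
have [sub nsub] := ltZ i ie.
have [f [fi fi']] := zclosed_separate zi nsub.
exists (msize f + C)%N => M; have [I [F [cI dF indF]]] := HC M.
exists ('I_M * I)%type, (fun ai : 'I_M * I => f ^+ ai.1 * F ai.2); split.
- by rewrite card_prod card_ord cI expnS.
- move=> [a j] /=; rewrite mulnDl; apply: leq_trans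
    (msizeM_leS (msizeX_leS (a := msize f) a _) (dF j)) _ => //.
  by rewrite ltnS leq_add2r mulnC leq_mul2l (ltnW (ltn_ord a)) orbT.
- exact: lin_indep_powers irr' sub fi fi' indF.
Qed.

End UpperBound.

(** The polynomials lie in the span of the monomials with all exponents at most [D], a space of
    dimension [D.+1 ^ d]. *)
Lemma box_dependence (k : fieldType) d (I : finType) (q : I -> {mpoly k[d]}) D :
  (forall i, (msize (q i) <= D.+1)%N) -> (D.+1 ^ d < #|I|)%N ->
  exists2 c : I -> k, \sum_i c i *: q i = 0 & exists i, c i != 0.
Proof.
move=> qD ltI; pose J := {ffun 'I_d -> 'I_D.+1}.
pose mn (a : J) := [multinom (a i : nat) | i < d].
pose A : 'M[k]_(#|I|, #|{: J}|) :=
  \matrix_(i, a) (q (enum_val i))@_(mn (enum_val a)).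
have rkA : (\rank A < #|I|)%N.
  by apply: leq_ltn_trans (rank_leq_col A) _; rewrite card_ffun !card_ord.
have /rowV0Pn[v vA v0] : kermx A != 0.
  by rewrite -mxrank_eq0 mxrank_ker -lt0n subn_gt0.
move/sub_kermxP: vA => vA.
exists (fun i => v 0 (enum_rank i)); last first.
  have /existsP[j vj] : [exists j, v 0 j != 0].
    rewrite -negb_forall; apply: contra v0 => /forallP v0.
    by apply/eqP/rowP => j; rewrite mxE; apply/eqP.
  by exists (enum_val j); rewrite enum_valK.
apply/mpolyP => m; rewrite mcoeff0 raddf_sum /=.
case: (boolP [forall i, m i < D.+1]%N) => [/forallP mD|/forallPn[i mi]].
  pose a : J := [ffun i => Ordinal (mD i)].
  have ma : mn a = m by apply/mnmP => i; rewrite mnmE ffunE.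
  move/matrixP/(_ 0 (enum_rank a)): vA; rewrite !mxE => vA.
  rewrite -[RHS]vA (reindex (@enum_val I I)) /=; last first.
    by apply: onW_bij; apply: enum_val_bij.
  by apply: eq_bigr => j _; rewrite mcoeffZ !mxE enum_valK enum_rankK ma.
apply: big1 => j _; rewrite mcoeffZ memN_msupp_eq0 ?mulr0 //.
apply: msize_mdeg_ge; apply: leq_trans (qD j) _.
by rewrite -leqNgt in mi; apply: leq_trans mi _; rewrite mdegE (bigD1 i) //= leq_addr.
Qed.

(** * Functions generated by [d] functions after inverting one of their polynomials *)

Section LocalizedGenerators.
Variables (k : fieldType) (n d : nat) (Z : affine_set k n).
Variables (h : 'rV[k]_n -> k) (y : 'I_d -> 'rV[k]_n -> k).

(* On [Z], the function [f] lies in [k[y_1, ..., y_d][1/h]]. *)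
Definition localized (f : 'rV[k]_n -> k) : Prop :=
  exists N (q : {mpoly k[d]}), forall x, Z x -> h x ^+ N * f x = q.@[fun i => y i x].

Hypothesis hP : exists q : {mpoly k[d]}, forall x, Z x -> h x = q.@[fun i => y i x].

Lemma localized_gen i : localized (y i).
Proof. by exists 0%N, 'X_i => x _; rewrite mul1r mevalXU. Qed.

Lemma localized_const c : localized (fun=> c).
Proof. by exists 0%N, c%:MP => x _; rewrite mul1r mevalC. Qed.

Lemma localized_ext f g : (forall x, Z x -> f x = g x) -> localized f -> localized g.
Proof. by move=> fg [N [q fq]]; exists N, q => x Zx; rewrite -fg // fq. Qed.

Lemma localized_pad f N (q : {mpoly k[d]}) N' : (N <= N')%N ->
  (forall x, Z x -> h x ^+ N * f x = q.@[fun i => y i x]) ->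
  exists q' : {mpoly k[d]}, forall x, Z x -> h x ^+ N' * f x = q'.@[fun i => y i x].
Proof.
move=> NN' fq; have [r hr] := hP; exists (r ^+ (N' - N) * q) => x Zx.
by rewrite mevalM rmorphXn /= -hr // -fq // mulrA -exprD subnK.
Qed.

Lemma localizedD f g : localized f -> localized g -> localized (fun x => f x + g x).
Proof.
move=> [N1 [q1 fq]] [N2 [q2 gq]].
have [q1' fq'] := localized_pad (leq_addr N2 N1) fq.
have [q2' gq'] := localized_pad (leq_addl N1 N2) gq.
exists (N1 + N2)%N, (q1' + q2') => x Zx.
by rewrite mulrDr mevalD -fq' // -gq'.
Qed.

Lemma localizedM f g : localized f -> localized g -> localized (fun x => f x * g x).
Proof.
move=> [N1 [q1 fq]] [N2 [q2 gq]]; exists (N1 + N2)%N, (q1 * q2) => x Zx.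
by rewrite mevalM -fq // -gq // exprD mulrACA.
Qed.

Lemma localizedN f : localized f -> localized (fun x => - f x).
Proof.
move=> lf; apply: localized_ext (localizedM (localized_const (-1)) lf) => x _.
by rewrite mulN1r.
Qed.

Lemma localizedB f g : localized f -> localized g -> localized (fun x => f x - g x).
Proof. by move=> lf lg; apply: localizedD => //; apply: localizedN. Qed.

Lemma localized_sum (I : Type) (r : seq I) (P : pred I) (f : I -> 'rV[k]_n -> k) :
  (forall i, P i -> localized (f i)) -> localized (fun x => \sum_(i <- r | P i) f i x).
Proof.
move=> lf; elim: r => [|i r IH].
  by apply: localized_ext (localized_const 0) => x _; rewrite big_nil.
have [Pi|Pi] := boolP (P i); last first.
  by apply: localized_ext IH => x _; rewrite big_cons (negbTE Pi).
by apply: localized_ext (localizedD (lf i Pi) IH) => x _; rewrite big_cons Pi.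
Qed.

Lemma localized_divh f : localized (fun x => h x * f x) -> localized f.
Proof.
by move=> [N [q fq]]; exists N.+1, q => x Zx; rewrite exprSr -mulrA fq.
Qed.

(** Clearing denominators costs only linearly in the degree [K], both in the exponent of [h] and in
    the degree of the numerator. This linearity is what the counting argument needs. *)
Lemma localized_deg : (forall u, localized (fun x => x 0 u)) ->
  exists N D, forall K (p : {mpoly k[n]}), (msize p <= K.+1)%N ->
    exists2 q : {mpoly k[d]}, (msize q <= (D * K).+1)%N
      & forall x, Z x -> h x ^+ (N * K) * p.@[x 0] = q.@[fun i => y i x].
Proof.
move=> gen; have [r hr] := hP.
have [N HN] : exists N, forall u, exists q : {mpoly k[d]}, forall x, Z x ->
    h x ^+ N * x 0 u = q.@[fun i => y i x].
  case: (fin_all_exists gen) => N HN; exists (\sum_u N u)%N => u.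
  have [q qu] := HN u; apply: localized_pad qu.
  by rewrite (bigD1 u) //= leq_addr.
have [Q HQ] := fin_all_exists HN.
(* [D] dominates the degree of [r ^+ N] and of each [Q u], so every unit of [K], whether a variable
   or a padding factor, costs at most [D]. *)
pose D := (N * msize r + \sum_u msize (Q u))%N.
exists N, D => K p pK.
pose mon m := r ^+ (N * (K - mdeg m)) * \prod_u Q u ^+ m u.
(* The test [mdeg m <= K] always succeeds on the support of [p]; it makes the degree bound true for
   every [m], as [msize_sum_le] requires. *)
exists (\sum_(m <- msupp p) p@_m *: (if (mdeg m <= K)%N then mon m else 0)).
  apply: msize_sum_le => m; apply: leq_trans (msizeZ_le _ _) _.
  have [mK|mK] := boolP (mdeg m <= K)%N; last by rewrite msize0.
  have -> : (D * K = D * (K - mdeg m) + D * mdeg m)%N by rewrite -mulnDr subnK.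
  apply: msizeM_leS.
    apply: leq_trans (msizeX_leS (a := msize r) _ _) _ => //.
    by rewrite ltnS /D mulnDl mulnAC leq_addr.
  rewrite mdegE big_distrr /=; apply: msize_prod_leS => u.
  apply: leq_trans (msizeX_leS (a := msize (Q u)) _ _) _ => //.
  rewrite ltnS mulnC leq_mul2r; apply/orP; right.
  by rewrite /D (bigD1 u) //=; lia.
move=> x Zx; rewrite mevalE mulr_sumr raddf_sum /= !big_seq; apply: eq_bigr => m mp.
have mK : (mdeg m <= K)%N by have := msize_mdeg_lt mp; lia.
rewrite mK mevalZ /mon mevalM rmorphXn /= -hr // rmorph_prod /= mulrCA; congr (_ * _).
rewrite -{1}(subnK mK) mulnDr exprD -mulrA; congr (_ * _).
rewrite mdegE big_distrr /= -prodrXr -big_split /=; apply: eq_bigr => u _.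
by rewrite rmorphXn /= -HQ // exprMn exprM.
Qed.

End LocalizedGenerators.

Section LocalizedPolynomials.
Variables (k : fieldType) (n d : nat) (Z : affine_set k n).
Variables (h : 'rV[k]_n -> k) (y : 'I_d -> 'rV[k]_n -> k).
Hypothesis hP : exists q : {mpoly k[d]}, forall x, Z x -> h x = q.@[fun i => y i x].

Definition localized_poly (P : 'rV[k]_n -> {poly k}) : Prop :=
  forall s, localized Z h y (fun x => (P x)`_s).

Lemma localized_poly0 : localized_poly (fun=> 0).
Proof.
by move=> s; apply: localized_ext (localized_const _ _ _ 0) => x _; rewrite coef0.
Qed.

Lemma localized_polyD P Q :
  localized_poly P -> localized_poly Q -> localized_poly (fun x => P x + Q x).
Proof.
by move=> lP lQ s; apply: localized_ext (localizedD hP (lP s) (lQ s)) => x _; rewrite coefD.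
Qed.

Lemma localized_polyN P : localized_poly P -> localized_poly (fun x => - P x).
Proof.
by move=> lP s; apply: localized_ext (localizedN (lP s)) => x _; rewrite coefN.
Qed.

Lemma localized_polyB P Q :
  localized_poly P -> localized_poly Q -> localized_poly (fun x => P x - Q x).
Proof. by move=> lP lQ; apply: localized_polyD => //; apply: localized_polyN. Qed.

Lemma localized_polyM P Q :
  localized_poly P -> localized_poly Q -> localized_poly (fun x => P x * Q x).
Proof.
move=> lP lQ s.
apply: (localized_ext (f := fun x => \sum_(i < s.+1) (P x)`_i * (Q x)`_(s - i))).
  by move=> x _; rewrite coefM.
by apply: (localized_sum hP) => i _; apply: localizedM; [apply: lP|apply: lQ].
Qed.

Lemma localized_poly_coefs m (E : 'rV[k]_n -> nat -> k) :
  (forall s, (s < m)%N -> localized Z h y (E^~ s)) ->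
  localized_poly (fun x => \poly_(s < m) E x s).
Proof.
move=> lE s; have [sm|ms] := ltnP s m.
  by apply: localized_ext (lE s sm) => x _; rewrite coef_poly sm.
by apply: localized_ext (localized_const _ _ _ 0) => x _; rewrite coef_poly ltnNge ms.
Qed.

End LocalizedPolynomials.

(** The [M ^ e] independent functions of degree at most [C * M] on [Z e] become, after
    multiplication by a power of [h], polynomials of degree at most [D * (C * M)] in [d] generators.
    A dependence among these would descend to the functions, since [h] can be cancelled on an
    irreducible set; hence [M ^ e] grows no faster than [M ^ d]. *)
Lemma irreducible_chain_le (k : fieldType) n d V e Z (h : {mpoly k[n]})
    (y : 'I_d -> 'rV[k]_n -> k) :
  irreducible_chain V e Z ->
  ~ (forall x, Z e x -> h.@[x 0] = 0) ->
  (exists q : {mpoly k[d]}, forall x, Z e x -> h.@[x 0] = q.@[fun i => y i x]) ->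
  (forall u, localized (Z e) (fun x => h.@[x 0]) y (fun x => x 0 u)) ->
  (e <= d)%N.
Proof.
move=> chZ h0 hP gen; have [N [D HD]] := localized_deg hP gen.
have [C HC] := irreducible_chain_indep chZ (leqnn e).
have [_ irrZ _] := chZ.1 e (leqnn e).
have bound M : (M ^ e <= (D * (C * M)).+1 ^ d)%N.
  rewrite leqNgt; apply/negP => ltM; have [I [F [cI dF indF]]] := HC M.
  have [Q HQ1 HQ2] := fin_all_exists2 (fun j => HD _ _ (dF j)).
  rewrite -cI in ltM; have [c c0 [i ci]] := box_dependence HQ1 ltM.
  move: ci; rewrite indF ?eqxx // => x Zx.
  pose p := \sum_i c i *: F i.
  case: (@zirreducible_mul _ _ (Z e) (h ^+ (N * (C * M))) p irrZ) => [x' Zx'|hz|pz].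
  - rewrite /p raddf_sum /= mulr_sumr rmorphXn /=.
    transitivity ((\sum_i c i *: Q i).@[fun i => y i x']); last by rewrite c0 meval0.
    rewrite raddf_sum /=; apply: eq_bigr => j _.
    by rewrite !mevalZ mulrCA HQ2.
  - case: h0; apply: (@zirreducible_exp _ _ _ _ (N * (C * M)) irrZ) => x' /hz.
    by rewrite rmorphXn.
  - by apply: etrans (pz x Zx); rewrite raddf_sum /=; apply: eq_bigr => j _; rewrite mevalZ.
rewrite leqNgt; apply/negP => de.
(* For [M = c ^ d + 1] and [d < e]: (D C M + 1)^d <= (c M)^d = c^d M^d < M^(d+1) <= M^e. *)
pose c := (D * C).+1; have cp : (0 < c ^ d)%N by rewrite expn_gt0.
have := bound (c ^ d).+1; set M := _.+1; apply/negP; rewrite -ltnNge.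
apply: (@leq_trans (M ^ d.+1)); last by rewrite leq_exp2l.
apply: (@leq_ltn_trans ((c * M) ^ d)); last first.
  by rewrite expnMn expnS ltn_mul2r expn_gt0 /M ltnSn.
have le_cM : ((D * (C * M)).+1 <= c * M)%N.
  by rewrite mulSn mulnA /M addSn ltnS leq_addl.
by case: (posnP d) => [->|d0]; rewrite ?expn0 ?leq_exp2r.
Qed.

Lemma rmorph_mmap n (R : nzRingType) (S T : comNzRingType) (f : R -> S)
    (g : {rmorphism S -> T}) (h : 'I_n -> S) (f' : R -> T) (h' : 'I_n -> T)
    (p : {mpoly R[n]}) :
  (forall c, g (f c) = f' c) -> (forall i, g (h i) = h' i) ->
  g (mmap f h p) = mmap f' h' p.
Proof.
move=> ff hh; rewrite /mmap rmorph_sum /=; apply: eq_bigr => m _.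
rewrite rmorphM /mmap1 rmorph_prod /= ff; congr (_ * _).
by apply: eq_bigr => i _; rewrite rmorphXn /= hh.
Qed.

(** * Polynomial functions and closures of polynomial images *)

Section PolynomialFunctions.
Variables (k : fieldType) (n : nat).

(** The case [h = 1] on the whole space, so that the closure properties of [localized] apply
    unchanged. *)
Definition polyfun (f : 'rV[k]_n -> k) : Prop :=
  localized (fun=> True) (fun=> 1) (fun i x => x 0 i) f.

Lemma polyfunP f : polyfun f <-> exists p : {mpoly k[n]}, forall x, f x = p.@[x 0].
Proof.
split=> [[N [p fp]]|[p fp]]; last by exists 0%N, p => x _; rewrite mul1r fp.
by exists p => x; rewrite -fp // expr1n mul1r.
Qed.

Lemma polyfun1 : exists q : {mpoly k[n]},
  forall x, True -> 1 = q.@[fun i => (x : 'rV[k]_n) 0 i].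
Proof. by exists 1 => x _; rewrite meval1. Qed.

Lemma polyfun_line f (x y : 'rV[k]_n) : polyfun f ->
  exists P : {poly k}, forall t, P.[t] = f (x + t *: (y - x)).
Proof.
case/polyfunP => p fp.
exists (mmap polyC (fun u => (x 0 u)%:P + (y 0 u - x 0 u) *: 'X) p) => t.
rewrite fp; apply: (rmorph_mmap (g := horner_eval t)) => [c|u].
  by rewrite /= /horner_eval hornerC.
by rewrite /= /horner_eval hornerD hornerC hornerZ hornerX !mxE mulrC.
Qed.

End PolynomialFunctions.

Lemma polyfun_comp (k : fieldType) d n (f : 'rV[k]_d -> 'rV[k]_n) g :
  (forall u, polyfun (fun w => f w 0 u)) -> polyfun g -> polyfun (fun w => g (f w)).
Proof.
move=> pf /polyfunP[p gp].
have [q fq] := fin_all_exists (fun u => (polyfunP _).1 (pf u)).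
apply/polyfunP; exists (p \mPo [tuple q u | u < n]) => w.
rewrite comp_mpoly_meval gp; apply: meval_eq => u.
by rewrite tnth_map tnth_ord_tuple -fq.
Qed.

Section LowerBound.
Variables (k : closedFieldType) (d n : nat).
Variables (phi : 'rV[k]_d -> 'rV[k]_n) (c : 'I_d -> 'rV[k]_n -> k).
Hypothesis phiP : forall u, polyfun (fun w => phi w 0 u).
Hypothesis cP : forall i, polyfun (c i).

Definition coord_flag i (w : 'rV[k]_d) : Prop := forall l : 'I_d, (i <= l)%N -> w 0 l = 0.

(** The Zariski closure of the image under [phi] of the span of the first [i] coordinate vectors. *)
Definition flag_image i : affine_set k n := zero_locus
  (fun p : {mpoly k[n]} => forall w, coord_flag i w -> p.@[phi w 0] = 0).

Lemma coord_flag_line i x y t :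
  coord_flag i x -> coord_flag i y -> coord_flag i (x + t *: (y - x)).
Proof. by move=> fx fy l il; rewrite !mxE fx ?fy // subrr mulr0 addr0. Qed.

Lemma flag_image_phi i w : coord_flag i w -> flag_image i (phi w).
Proof. by move=> fw p; apply. Qed.

(** Two parameters witnessing that neither closed set contains the image are joined by a line inside
    the coordinate subspace; along it both witnessing polynomials become nonzero polynomials in one
    variable. *)
Lemma flag_image_irreducible i : zirreducible (flag_image i).
Proof.
split; first by exists (phi 0); apply: flag_image_phi => l _; rewrite mxE.
move=> B C [SB HB] [SC HC] sBC; apply: NNPP => /not_or_and[nB nC].
have wit (D : affine_set k n) SD : (forall x, D x <-> zero_locus SD x) ->
    ~ subset_aff (flag_image i) D ->
    exists (p : {mpoly k[n]}) w, [/\ SD p, coord_flag i w & p.@[phi w 0] != 0].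
  move=> HD nD; apply: NNPP => nex; apply: nD => x Zx; apply/HD => p Sp.
  apply: Zx => w fw; apply: NNPP => /eqP pw; apply: nex.
  by exists p, w.
have [p [w1 [Sp fw1 pw1]]] := wit _ _ HB nB.
have [q [w2 [Sq fw2 qw2]]] := wit _ _ HC nC.
have line (r : {mpoly k[n]}) : exists P : {poly k},
    forall t, P.[t] = r.@[phi (w1 + t *: (w2 - w1)) 0].
  apply: polyfun_line (polyfun_comp (g := fun x => r.@[x 0]) phiP _).
  by apply/polyfunP; exists r.
have [P HP] := line p; have [Q HQ] := line q.
have P0 : P != 0.
  by apply: contraNneq pw1 => P0; rewrite -(addr0 w1) -(scale0r (w2 - w1)) -HP P0 horner0.
have Q0 : Q != 0.
  apply: contraNneq qw2 => Q0.
  by rewrite -[w2](subrK w1) addrC -[w2 - w1]scale1r -HQ Q0 horner0.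
(* An algebraically closed field is infinite, so some point of the line avoids the roots of both. *)
have /closed_nonrootP[t] : P * Q != 0 by rewrite mulf_neq0.
rewrite rootM negb_or !rootE HP HQ => /andP[nzp nzq].
have /flag_image_phi/sBC := coord_flag_line t fw1 fw2.
by case=> [/HB/(_ p Sp)|/HC/(_ q Sq)] e; rewrite e eqxx in nzp nzq.
Qed.

(** Strictness is detected by [c i]: it vanishes on the image of the [i]-th subspace, hence on the
    closure, but not on the image of the next one. *)
Lemma flag_chain (V : affine_set k n) : zclosed V -> (forall w, V (phi w)) ->
  (forall (i : 'I_d) w, coord_flag i w -> c i (phi w) = 0) ->
  (forall i : 'I_d, exists2 w, coord_flag i.+1 w & c i (phi w) != 0) ->
  irreducible_chain V d flag_image.
Proof.
move=> [S VS] Vphi c0 c1; split=> i id.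
  split; first by eexists => x; split; apply.
    exact: flag_image_irreducible.
  by move=> x Zx; apply/VS => p Sp; apply: Zx => w _; move/VS: (Vphi w); apply.
split=> [x Zx p pi|sub].
  by apply: Zx => w fw; apply: pi => l il; apply: fw; apply: ltnW.
have [w fw] := c1 (Ordinal id); case/eqP.
have /polyfunP[p cp] := cP (Ordinal id).
rewrite cp; apply: (sub _ (flag_image_phi fw)) => w' fw'.
by rewrite -cp c0.
Qed.

End LowerBound.

(** * The equations *)

(** Stated for an arbitrary assignment [P], so that the right-hand sides can be evaluated at the
    partial polynomials and at products of a power of t with a slice. *)
Definition quad_of (R : comNzRingType) (P : bool -> nat -> nat -> R) (e : nat) : R :=
  let fl a i := \sum_(j <- residues a i) P a i j in
  let g i := fl G i in let f i := fl F i in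
  nth 0
  [:: P F 6%N 1%N * f 9%N + P F 6%N 3%N * g 7%N + (P F 6%N 4%N - P G 8%N 4%N) * f 6%N
      - P G 8%N 5%N * g 5%N - P G 8%N 6%N * g 4%N;
      P F 6%N 1%N * f 10%N + P F 6%N 3%N * f 8%N - P F 9%N 6%N * g 5%N - P F 9%N 1%N * g 4%N;
      P F 8%N 4%N * g 8%N + P F 8%N 5%N * g 7%N - P F 9%N 6%N * g 6%N + P F 8%N 6%N * f 6%N
      - P F 9%N 1%N * g 5%N;
      P F 8%N 4%N * f 9%N + (P F 8%N 5%N - P F 10%N 5%N) * f 8%N - P F 10%N 6%N * g 7%N
      - P F 10%N 1%N * g 6%N - P F 10%N 2%N * g 5%N;
      P F 9%N 6%N * f 8%N - P F 10%N 5%N * f 9%N - P F 10%N 6%N * g 8%N - P F 10%N 1%N * g 7%N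
      - P F 10%N 2%N * f 6%N] e.

Section Unknowns.
Variable tau : nat.
Local Notation n := (nunk tau).

Definition unk (u : 'I_n) : bool * nat * nat := tnth (in_tuple (unknowns tau)) u.

Lemma residues_range a i j : j \in residues a i -> (1 <= j <= 6)%N.
Proof.
by do 11?[case: i => [|i]]; case: a; rewrite ?inE => // /orP;
  repeat case; repeat (case/orP => //); move/eqP=> ->.
Qed.

Lemma is_unknown_index a i r : is_unknown tau (a, i, r) -> (i < 11)%N.
Proof.
case/and3P => _ _ /hasP[j + _].
by case: a; do 11?[case: i => [//|i]].
Qed.

Lemma fdeg_lt a i j : j \in residues a i -> (fdeg tau a i j < 12 * tau + 11)%N.
Proof.
move=> ji; have := residues_range ji.
by case: a ji; do 11?[case: i => [|i]] => //; do 7?[case: j => [|j]] => //; rewrite /=; lia.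
Qed.

Lemma mem_unknowns c : (c \in unknowns tau) = is_unknown tau c.
Proof.
rewrite mem_filter; case: c => -[a i] r; apply/andP/idP => [[]//|ok]; split=> //.
apply/allpairsPdep; exists (a, i), r; split=> //=; last first.
  rewrite mem_iota /=; case/and3P: ok => _ _ /hasP[j /fdeg_lt + /andP[_ +]]; lia.
by have := is_unknown_index ok; case: a {ok}; do 11?[case: i => [//|i]].
Qed.

Lemma unknowns_uniq : uniq (unknowns tau).
Proof.
apply: filter_uniq; apply: allpairs_uniq; rewrite ?iota_uniq //.
by move=> [[? ?] ?] [[? ?] ?] _ _ [-> -> ->].
Qed.

Lemma unkP u : is_unknown tau (unk u).
Proof. by rewrite -mem_unknowns mem_tnth. Qed.

Lemma unk_inj : injective unk.
Proof. by move=> u v; apply/tuple_uniqP/unknowns_uniq. Qed.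

Lemma unk_surj c : is_unknown tau c -> exists u, unk u = c.
Proof. by rewrite -mem_unknowns => /(tnthP (in_tuple _))[u ->]; exists u. Qed.

Lemma unk_gt0 u : (0 < (unk u).2)%N.
Proof. by have := unkP u; case: (unk u) => -[a i] r /and3P[]. Qed.

Lemma unk_lt u : ((unk u).2 < 12 * tau + 11)%N.
Proof.
have := unkP u; case: (unk u) => -[a i] r /and3P[_ _ /hasP[j /fdeg_lt]] /=.
by move=> + /andP[_]; lia.
Qed.

Section Generic.
Variable R : comNzRingType.
Implicit Types W : 'I_n -> R.

(** The coefficients [W] range over any commutative ring: the identities are needed at the variables
    themselves, at points, and along polynomial curves of points. *)
Definition part W (a : bool) (i j : nat) : {poly R} :=
  \sum_(u < n | let: (b, l, r) := unk u in [&& b == a, l == i & r == j %[mod 6]])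
    (W u)%:P * 'X^((unk u).2).

Definition full W a i : {poly R} := \sum_(j <- residues a i) part W a i j.

Definition lin W (e : nat) : {poly R} := nth 0
  [:: full W G 4 - full W F 6 + full W G 8;
      full W G 5 - full W F 6 + full W F 9;
      full W G 6 - full W F 6 - full W F 8 + full W F 9;
      full W G 7 - full W F 8 + full W F 10;
      full W G 8 - full W F 8 - full W F 9 + full W F 10] e.

Definition quad W : nat -> {poly R} := quad_of (part W).

Lemma full_sum W a i :
  full W a i = \sum_(u < n | (unk u).1 == (a, i)) (W u)%:P * 'X^((unk u).2).
Proof.
rewrite /full /part (exchange_big_dep (fun u => (unk u).1 == (a, i))) /=; last first.
  by move=> j u _; case: (unk u) => -[b l] r /and3P[/eqP-> /eqP->].
apply: eq_bigr => u /eqP ui.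
have := unkP u; move: ui; case: (unk u) => -[b l] r /= [-> ->] /and3P[_ _ /hasP[j ji]].
case/andP => rj _; rewrite -big_filter (_ : [seq _ <- _ | _] = [:: j]) ?big_seq1 //.
rewrite (eq_in_filter (a2 := pred1 j)) => [|j' j'i]; last first.
  rewrite !eqxx /= (eqP rj); apply/eqP/eqP => [|->//].
  by have := residues_range ji; have := residues_range j'i; lia.
rewrite filter_pred1_uniq //.
by move: ji; case: a {rj}; do 11?[case: i => [//|i]].
Qed.

Lemma coef_full W a i m :
  (full W a i)`_m = \sum_(u < n | ((unk u).1 == (a, i)) && ((unk u).2 == m)) W u.
Proof.
rewrite full_sum coef_sum [RHS]big_mkcondr /=; apply: eq_bigr => u _.
by rewrite coefCM coefXn eq_sym; case: eqP => _; rewrite ?mulr1 ?mulr0.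
Qed.

Lemma coef_part W a i j m : (part W a i j)`_m =
  \sum_(u < n | ((unk u).1 == (a, i)) && ((unk u).2 == m)) (if (m == j %[mod 6]) then W u else 0).
Proof.
rewrite /part coef_sum big_mkcond [RHS]big_mkcond /=; apply: eq_bigr => u _.
case: (unk u) => -[b l] r /=; rewrite coefCM coefXn xpair_eqE -andbA.
case: (b == a); rewrite ?andbF //=; case: (l == i) => //=.
by rewrite (eq_sym m r); have [->|_] := eqVneq r m; rewrite ?mulr1 ?mulr0 ?if_same.
Qed.

Lemma eq_part W W' : W =1 W' -> forall a i j, part W a i j = part W' a i j.
Proof. by move=> WW' a i j; apply: eq_bigr => u _; rewrite WW'. Qed.

Lemma eq_full W W' : W =1 W' -> full W =2 full W'.
Proof. by move=> WW' a i; apply: eq_bigr => j _; apply: eq_part. Qed.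

Lemma eq_lin W W' : W =1 W' -> lin W =1 lin W'.
Proof. by move=> WW' e; rewrite /lin !(eq_full WW'). Qed.

Lemma eq_quad W W' : W =1 W' -> quad W =1 quad W'.
Proof. by move=> WW' e; rewrite /quad /quad_of -!/(full _ _ _) !(eq_full WW') !(eq_part WW'). Qed.

Lemma coef_full0 W a i : (full W a i)`_0 = 0.
Proof.
by rewrite coef_full big1 // => u /andP[_ /eqP u0]; have := unk_gt0 u; rewrite u0.
Qed.

Lemma coef_part0 W a i j : (part W a i j)`_0 = 0.
Proof.
by rewrite coef_part big1 // => u /andP[_ /eqP u0]; have := unk_gt0 u; rewrite u0.
Qed.

End Generic.

Lemma map_part (R S : comNzRingType) (phi : {rmorphism R -> S}) W a i j :
  map_poly phi (part W a i j) = part (phi \o W) a i j.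
Proof.
rewrite /part rmorph_sum /=; apply: eq_bigr => u _.
by rewrite rmorphM /= map_polyC map_polyXn.
Qed.

Lemma map_full (R S : comNzRingType) (phi : {rmorphism R -> S}) W a i :
  map_poly phi (full W a i) = full (phi \o W) a i.
Proof. by rewrite /full rmorph_sum /=; apply: eq_bigr => j _; rewrite map_part. Qed.

Lemma map_lin (R S : comNzRingType) (phi : {rmorphism R -> S}) W e :
  map_poly phi (lin W e) = lin (phi \o W) e.
Proof.
by do 6?[case: e => [|e]]; rewrite /lin /= ?(rmorphD, rmorphN, rmorph0) /= ?map_full.
Qed.

Lemma map_quad (R S : comNzRingType) (phi : {rmorphism R -> S}) W e :
  map_poly phi (quad W e) = quad (phi \o W) e.
Proof.
by do 6?[case: e => [|e]];
  rewrite /quad /quad_of -?/(full _ _ _) /= ?(rmorphD, rmorphN, rmorphM, rmorph0) /=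
    ?(map_full, map_part).
Qed.

Section Additivity.
Variable R : comNzRingType.
Implicit Types W : 'I_n -> R.

Lemma partZ c W a i j : part (fun u => c * W u) a i j = c%:P * part W a i j.
Proof.
by rewrite /part mulr_sumr; apply: eq_bigr => u _; rewrite polyCM mulrA.
Qed.

Lemma fullZ c W a i : full (fun u => c * W u) a i = c%:P * full W a i.
Proof. by rewrite /full mulr_sumr; apply: eq_bigr => j _; rewrite partZ. Qed.

Lemma quadZ c W e : quad (fun u => c * W u) e = (c ^+ 2)%:P * quad W e.
Proof.
rewrite rmorphXn /=.
do 6?[case: e => [|e]]; rewrite /quad /quad_of -?/(full _ _ _) /= ?(partZ, fullZ) ?mulr0 //; ring.
Qed.

Lemma fullD W W' a i : full (fun u => W u + W' u) a i = full W a i + full W' a i.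
Proof.
rewrite !full_sum -big_split /=; apply: eq_bigr => u _.
by rewrite polyCD mulrDl.
Qed.

Lemma linD W W' e : lin (fun u => W u + W' u) e = lin W e + lin W' e.
Proof.
by do 6?[case: e => [|e]]; rewrite /lin /= ?fullD ?addr0 //; ring.
Qed.

Lemma linZ c W e : lin (fun u => c * W u) e = c%:P * lin W e.
Proof.
by do 6?[case: e => [|e]]; rewrite /lin /= ?fullZ ?mulr0 //; ring.
Qed.

Lemma linB W W' e : lin (fun u => W u - W' u) e = lin W e - lin W' e.
Proof.
rewrite (eq_lin (W' := fun u => W u + (-1) * W' u)) => [|u]; last by rewrite mulN1r.
by rewrite linD linZ polyCN mulN1r.
Qed.

Definition lsign (e : nat) (ai : bool * nat) : R :=
  let d (a : bool) (i : nat) : R := (ai == (a, i))%:R in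
  nth 0 [:: d G 4%N - d F 6%N + d G 8%N; d G 5%N - d F 6%N + d F 9%N;
            d G 6%N - d F 6%N - d F 8%N + d F 9%N; d G 7%N - d F 8%N + d F 10%N;
            d G 8%N - d F 8%N - d F 9%N + d F 10%N] e.

Lemma coef_lin W e m :
  (lin W e)`_m = \sum_(u < n | (unk u).2 == m) lsign e (unk u).1 * W u.
Proof.
have fullE a i : (full W a i)`_m =
    \sum_(u < n | (unk u).2 == m) ((unk u).1 == (a, i))%:R * W u.
  rewrite coef_full (eq_bigl (fun u => ((unk u).2 == m) && ((unk u).1 == (a, i)))).
    rewrite big_mkcondr /=; apply: eq_bigr => u _.
    by case: eqP; rewrite ?mul1r ?mul0r.
  by move=> u; rewrite andbC.
do 6?[case: e => [|e]]; rewrite /lin /lsign /= ?coefD ?coefN ?coefD ?coefN ?fullE.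
all: rewrite -?sumrN -?big_split /= -?sumrN -?big_split /=.
all: try by apply: eq_bigr => u _; ring.
all: by rewrite coef0 big1 // => u _; rewrite mul0r.
Qed.

End Additivity.
End Unknowns.

Section Dependence.
Variables (tau : nat) (R : comNzRingType).
Implicit Types (W : 'I_(nunk tau) -> R) (A B C D : {poly R}).

Definition agree m A B : Prop :=
  [/\ A`_0 = 0, B`_0 = 0 & forall i, (i < m)%N -> A`_i = B`_i].

Lemma agreeB m A B C D : agree m A B -> agree m C D -> agree m (A - C) (B - D).
Proof.
move=> [a b ab] [c d cd]; split=> [||i im]; rewrite !coefB ?a ?b ?c ?d ?subrr //.
by rewrite ab ?cd.
Qed.

Lemma agree_coefM m A B C D : agree m A B -> agree m C D -> (A * C)`_m = (B * D)`_m.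
Proof.
move=> [a b ab] [c d cd]; rewrite !coefM; apply: eq_bigr => i _.
have [i0|i0] := eqVneq (i : nat) 0%N; first by rewrite i0 a b !mul0r.
have [im|im] := eqVneq (i : nat) m; first by rewrite im subnn c d !mulr0.
have := ltn_ord i; rewrite ltnS => lem.
by rewrite ab ?cd //; lia.
Qed.

(** Since all weights are positive, the coefficient of t^m in a product of two such polynomials
    involves only coefficients of weight below [m]. This drives every induction on the weight. *)
Lemma quad_agree W W' e m :
  (forall u, ((unk u).2 < m)%N -> W u = W' u) -> (quad W e)`_m = (quad W' e)`_m.
Proof.
move=> WW'.
have agP a i j : agree m (part W a i j) (part W' a i j).
  split; rewrite ?coef_part0 // => r rm; rewrite !coef_part.
  by apply: eq_bigr => u /andP[_ /eqP ur]; rewrite WW' // ur.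
have agF a i : agree m (full W a i) (full W' a i).
  split; rewrite ?coef_full0 // => r rm; rewrite !coef_full.
  by apply: eq_bigr => u /andP[_ /eqP ur]; rewrite WW' // ur.
have FF a i j a' i' : (part W a i j * full W a' i')`_m = (part W' a i j * full W' a' i')`_m.
  exact: agree_coefM.
have BF a i j b l r a' i' : ((part W a i j - part W b l r) * full W a' i')`_m =
    ((part W' a i j - part W' b l r) * full W' a' i')`_m.
  by apply: agree_coefM => //; apply: agreeB.
by do 6?[case: e => [|e]]; rewrite /quad /quad_of -?/(full _ _ _) /= ?(coefD, coefN) ?(FF, BF).
Qed.

End Dependence.

Lemma lsign_morph (R S : comNzRingType) (phi : {rmorphism R -> S}) e ai :
  phi (lsign R e ai) = lsign S e ai.
Proof.
by do 6?[case: e => [|e]]; rewrite /lsign /= ?(rmorphD, rmorphN, rmorph0) ?rmorph_nat.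
Qed.

Lemma identity_ge5 tau (R : comNzRingType) (W : 'I_(nunk tau) -> R) e :
  (5 <= e)%N -> lin W e = 0 /\ quad W e = 0.
Proof. by move=> e5; rewrite /lin /quad /quad_of !nth_default. Qed.

(** * Expansion of the equations along lines and curves *)

Section Rho.
Variables (k : fieldType) (tau : nat).
Local Notation n := (nunk tau).
Local Notation rho := (@rho k tau).

Lemma rhoE j : rho j =
  (lin (fun u : 'I_n => 'X_u : {mpoly k[n]}) j.1)`_j.2 - (quad (fun u : 'I_n => 'X_u) j.1)`_j.2.
Proof. by rewrite -coefB; case: j => -[[|[|[|[|[|//]]]]] ?]. Qed.

Lemma morph_rho (S : comNzRingType) (phi : {rmorphism {mpoly k[n]} -> S})
    (W : 'I_n -> S) j : (forall u, phi 'X_u = W u) ->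
  phi (rho j) = (lin W j.1)`_j.2 - (quad W j.1)`_j.2.
Proof.
move=> phiW; rewrite rhoE rmorphB /= -!coef_map map_lin map_quad.
by rewrite (eq_lin phiW) (eq_quad phiW).
Qed.

(** Substituting a multiple of [x] by the parameter ['X] is a ring morphism whose coefficients are
    the values at [x] of the homogeneous components. *)
Definition line (x : 'rV[k]_n) (p : {mpoly k[n]}) : {poly k} :=
  mmap polyC (fun u => 'X * (x 0 u)%:P) p.

HB.instance Definition _ x := GRing.RMorphism.copy (line x) (line x).

Lemma line_X x u : line x 'X_u = 'X * (x 0 u)%:P.
Proof. by rewrite /line mmapX mmap1U. Qed.

Lemma coef_line x p d : (line x p)`_d = (pihomog mdeg d p).@[x 0].
Proof.
rewrite /line /mmap pihomogE coef_sum raddf_sum /= [RHS]big_mkcond /=.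
apply: eq_bigr => m _; rewrite coefCM /mmap1.
have -> : \prod_i ('X * (x 0 i)%:P) ^+ m i = 'X^(mdeg m) * (\prod_i x 0 i ^+ m i)%:P.
  rewrite rmorph_prod /= mdegE -prodrXr -big_split /=; apply: eq_bigr => i _.
  by rewrite exprMn rmorphXn.
rewrite coefMC coefXn eq_sym; case: eqP => _; last by rewrite mul0r mulr0.
by rewrite mul1r mevalZ mevalX.
Qed.

Lemma pihomog1_rho (x : 'rV[k]_n) j :
  (pihomog mdeg 1 (rho j)).@[x 0] = (lin (x 0) j.1)`_j.2.
Proof.
rewrite -coef_line (morph_rho _ (line_X x)) linZ quadZ !coefCM coefB coefXM coefXnM /=.
rewrite (_ : (lin (fun u => (x 0 u)%:P) j.1)`_j.2 = ((lin (x 0) j.1)`_j.2)%:P) ?coefC ?subr0 //.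
by rewrite -coef_map map_lin.
Qed.

Lemma T_H_lin (x : 'rV[k]_n) : T_H x <-> forall e, lin (x 0) e = 0.
Proof.
split=> [Tx e|Lx j]; last by rewrite pihomog1_rho Lx coef0.
have [lt|ge] := ltnP e 5.
  by apply/polyP => m; move: (Tx (Ordinal lt, m)); rewrite pihomog1_rho coef0.
by have [] := identity_ge5 (x 0) ge.
Qed.

Lemma coef_lin_coef (w : 'I_n -> {poly k}) e m d :
  (lin w e)`_m`_d = (lin (fun u => (w u)`_d) e)`_m.
Proof.
rewrite !coef_lin coef_sum; apply: eq_bigr => u _.
by rewrite -(lsign_morph (polyC : {rmorphism k -> {poly k}})) coefCM.
Qed.

Lemma horner_quad (w : 'I_n -> {poly k}) e m :
  (quad w e)`_m`_0 = (quad (fun u => (w u)`_0) e)`_m.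
Proof.
rewrite -[LHS]horner_coef0 -[_.[0]]/(horner_eval 0 _) -coef_map map_quad.
have h0 u : (horner_eval 0 \o w) u = (w u)`_0 by rewrite /= /horner_eval horner_coef0.
by apply: quad_agree.
Qed.

(** A curve through 0 is divisible by the parameter, and the quadratic parts are then divisible by
    its square. *)
Lemma quad_coef12 (w : 'I_n -> {poly k}) e m : (forall u, (w u)`_0 = 0) ->
  (quad w e)`_m`_1 = 0 /\ (quad w e)`_m`_2 = (quad (fun u => (w u)`_1) e)`_m.
Proof.
move=> w0; pose w' u := \poly_(i < size (w u)) (w u)`_i.+1.
have ww' u : w u = 'X * w' u.
  apply/polyP => -[|i]; rewrite coefXM ?w0 //= coef_poly.
  by case: ltnP => // /(leq_trans)/(_ (leqnSn _))/leq_sizeP ->.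
have -> : (quad w e)`_m = 'X^2 * (quad w' e)`_m.
  by rewrite -coefCM -quadZ; apply: quad_agree => u _.
rewrite !coefXnM /=; split=> //; rewrite horner_quad; apply: quad_agree => u _.
by rewrite ww' coefXM.
Qed.

End Rho.

Section QuadraticCone.
Variables (k : fieldType) (tau : nat).
Local Notation n := (nunk tau).
Local Notation rho := (@rho k tau).

(* The homogeneous part of degree 2 of the elimination amounts to asking for a
   second order solution above the tangent vector [x], whatever was eliminated. *)
Lemma Q_H_second_order E B s (x : 'rV[k]_n) : @is_elimination k tau E B s ->
  Q_H s x <-> T_H x /\ exists y : 'rV[k]_n, forall e, lin (y 0) e = quad (x 0) e.
Proof.
move=> [uni _ BT [sX _] Bs].
(* This curve solves the equations of [B] to all orders. For [x] in [T_H] its coefficients of order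
   0 and 1 turn out to be 0 and [x], and that of order 2 is the candidate for a second order
   solution. *)
pose w u := line x (tnth s u).
have rho_line j : line x (rho j \mPo s) = (lin w j.1)`_j.2 - (quad w j.1)`_j.2.
  rewrite -[LHS]/((line x \o comp_mpoly s) (rho j)); apply: morph_rho => u.
  by rewrite /= comp_mpolyXU -tnth_nth.
have linB_TH (z : 'rV[k]_n) : (forall j, j \in B -> (lin (z 0) j.1)`_j.2 = 0) -> T_H z.
  by move=> Bz; apply: BT => j jB; rewrite pihomog1_rho Bz.
have unique (z z' : 'rV[k]_n) : T_H z -> T_H z' ->
    (forall u, u \notin E -> z 0 u = z' 0 u) -> z = z'.
  move=> Tz Tz' zz'; have [v [_ vu]] := uni z'.
  by rewrite -(vu z) ?(vu z').
have lin_row (f : 'I_n -> k) e : lin ((\row_u f u : 'rV[k]_n) 0) e = lin f e.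
  by apply/polyP => m; rewrite !coef_lin; apply: eq_bigr => u _; rewrite mxE.
have wE u : u \notin E -> w u = 'X * (x 0 u)%:P by move=> uE; rewrite /w sX ?line_X.
have lin_quad j : j \in B -> (lin w j.1)`_j.2 = (quad w j.1)`_j.2.
  by move=> jB; apply/eqP; rewrite -subr_eq0 -rho_line Bs // rmorph0.
have T0 : T_H (0 : 'rV[k]_n).
  apply/T_H_lin => e; apply/polyP => m; rewrite coef_lin coef0 big1 // => u _.
  by rewrite mxE mulr0.
(* At weight [m], an equation of [B] equates the linear part of the constant terms with quadratic
   terms of smaller weight, which vanish by induction. The constant terms of weight [m] thus form a
   point of [T_H] that is zero outside [E], hence zero. *)
have w0 m : forall u, ((unk u).2 < m)%N -> (w u)`_0 = 0.
  elim: m => [//|m IH] u; rewrite ltnS leq_eqVlt => /orP[/eqP um|]; last exact: IH.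
  pose z : 'rV[k]_n := \row_v (if (unk v).2 == m then (w v)`_0 else 0).
  suff z0 : z = 0 by move/rowP/(_ u): z0; rewrite !mxE um eqxx.
  apply: unique => // [|v vE]; last first.
    by rewrite !mxE wE // coefXM; case: ifP.
  apply: linB_TH => j jB; rewrite lin_row coef_lin.
  have [jm|jm] := eqVneq j.2 m; last first.
    by rewrite big1 // => v /eqP ->; rewrite (negbTE jm) mulr0.
  transitivity ((lin w j.1)`_j.2)`_0.
    rewrite coef_lin_coef coef_lin; apply: eq_bigr => v /eqP ->.
    by rewrite jm eqxx.
  rewrite lin_quad // horner_quad.
  transitivity ((quad (fun u : 'I_n => 0 * (0 : k)) j.1)`_j.2).
    by apply: quad_agree => v; rewrite jm mul0r; apply: IH.
  by rewrite quadZ expr0n /= mul0r coef0.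
have {}w0 u : (w u)`_0 = 0 by apply: (w0 (unk u).2.+1).
have h2E : T_H x -> forall j, (pihomog mdeg 2 (rho j \mPo s)).@[x 0] =
    (lin (fun u => (w u)`_2) j.1)`_j.2 - (quad (x 0) j.1)`_j.2.
  move=> Tx; have w1 : \row_u (w u)`_1 = x.
    apply: unique => // [|u uE]; last by rewrite mxE wE // coefXM coefC.
    apply: linB_TH => j jB; rewrite lin_row -coef_lin_coef lin_quad //.
    by case: (quad_coef12 j.1 j.2 w0).
  move=> j; rewrite -coef_line rho_line coefB coef_lin_coef.
  have [_ ->] := quad_coef12 j.1 j.2 w0; congr (_ - _).
  by apply: quad_agree => u _; rewrite -[in RHS]w1 mxE.
split=> -[Tx].
  move=> Qx; split=> //; exists (\row_u (w u)`_2) => e; rewrite lin_row.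
  have [lt|ge] := ltnP e 5.
    apply/polyP => m; apply/eqP; rewrite -subr_eq0.
    by rewrite -(h2E Tx (Ordinal lt, m)) Qx.
  by have [_ ->] := identity_ge5 (x 0) ge; case: (identity_ge5 (fun u => (w u)`_2) ge).
move=> [y Ly]; split=> // j; rewrite h2E // -Ly.
(* On [B] both [y] and the second coefficients of [w] give the linear parts the values of the
   quadratic parts at [x], so they differ by a point of [T_H], and their linear parts agree for
   every equation. *)
have /T_H_lin/(_ j.1) : T_H (\row_u ((w u)`_2 - y 0 u)).
  apply: linB_TH => i iB; rewrite lin_row linB coefB Ly -coef_lin_coef lin_quad //.
  have [_ ->] := quad_coef12 i.1 i.2 w0.
  have := h2E Tx i; rewrite Bs // pihomog0 meval0 => /esym/eqP; rewrite subr_eq0 => /eqP <-.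
  by rewrite -coef_lin_coef lin_quad //; have [_ ->] := quad_coef12 i.1 i.2 w0; rewrite subrr.
by rewrite lin_row linB => /polyP/(_ j.2); rewrite coefB coef0.
Qed.

End QuadraticCone.

(** * Existence of an elimination *)

Section Elimination.
Variables (k : fieldType) (tau : nat).
Local Notation n := (nunk tau).
Local Notation rho := (@rho k tau).
Local Notation I := ('I_5 * 'I_(12 * tau + 11))%type.

Let eqn (b : 'I_#|{: I}|) : eqn_index := ((enum_val b).1, val (enum_val b).2).

(** No unknown has weight [12 * tau + 11] or more, so this finite matrix carries all the linear
    equations. Maximal independent rows give [B]; maximal independent columns of these rows give
    [E], with invertible minor [M]. *)
Let A : 'M[k]_(#|{: I}|, n) := \matrix_(b, u)
  if (unk u).2 == (eqn b).2 then lsign k (eqn b).1 (unk u).1 else 0.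

Let r := \rank A.
Let f : 'I_r -> 'I_#|{: I}| := maxrankfun A.
Let C : 'M[k]_(r, n) := rowsub f A.

Let C_full : row_full C^T.
Proof. by rewrite /row_full mxrank_tr; apply: maxrowsub_free. Qed.

Let g : 'I_r -> 'I_n := fullrankfun C_full.
Let E : {set 'I_n} := g @: 'I_r.
Let B : seq eqn_index := [seq eqn (f b) | b <- enum 'I_r].

Let M : 'M[k]_r := colsub g C.

Let M_unit : M \in unitmx.
Proof.
have := fullrowsub_unit C_full; rewrite -unitmx_tr; congr (_ \in unitmx).
by apply/matrixP => i j; rewrite !mxE.
Qed.

(** A right inverse of [C] supported on the rows in [E]: errors in the equations of [B] can be
    corrected without touching the coordinates of [T_H]. *)
Let H : 'M[k]_(n, r) := (\matrix_(u, i) (u == g i)%:R) *m invmx M.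

Let C_H : C *m H = 1%:M.
Proof.
rewrite mulmxA [X in X *m _](_ : _ = M) ?mulmxV //.
apply/matrixP => i j; rewrite !mxE (bigD1 (g j)) //= !mxE eqxx mulr1.
by rewrite big1 ?addr0 // => u /negbTE uj; rewrite !mxE uj mulr0.
Qed.

Let g_inj : injective g.
Proof. exact: fullrankfun_inj. Qed.

Let H_off u i : u \notin E -> H u i = 0.
Proof.
move=> uE; rewrite mxE big1 // => j _; rewrite mxE; case: eqP => [uj|_].
  by rewrite uj imset_f in uE.
by rewrite mul0r.
Qed.

Let off_col (x : 'cV[k]_n) : (forall u, u \notin E -> x u 0 = 0) -> C *m x = 0 -> x = 0.
Proof.
move=> xE Cx.
suff xg : x = (\matrix_(u, i) (u == g i)%:R) *m (\col_i x (g i) 0).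
  move: Cx; rewrite xg mulmxA [X in X *m _](_ : _ = M); last first.
    apply/matrixP => i j; rewrite !mxE (bigD1 (g j)) //= !mxE eqxx mulr1.
    by rewrite big1 ?addr0 // => u /negbTE uj; rewrite !mxE uj mulr0.
  by move/(congr1 (mulmx (invmx M))); rewrite mulmxA mulVmx // mul1mx mulmx0 => ->; rewrite mulmx0.
apply/colP => u; rewrite !mxE; have [/imsetP[i _ ->]|uE] := boolP (u \in E).
  rewrite (bigD1 i) //= !mxE eqxx mul1r big1 ?addr0 // => j ji.
  by rewrite !mxE (inj_eq g_inj) eq_sym (negbTE ji) mul0r.
rewrite xE // big1 // => i _; rewrite !mxE; case: eqP => [ui|_]; last by rewrite mul0r.
by rewrite ui imset_f in uE.
Qed.

Let lin_A (x : 'rV[k]_n) b : (A *m x^T) b 0 = (lin (x 0) (eqn b).1)`_(eqn b).2.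
Proof.
rewrite mxE coef_lin [RHS]big_mkcond /=; apply: eq_bigr => u _; rewrite !mxE.
by case: ifP => // _; rewrite mul0r.
Qed.

Let lin_C (x : 'rV[k]_n) i : (C *m x^T) i 0 = (lin (x 0) (eqn (f i)).1)`_(eqn (f i)).2.
Proof. by rewrite -lin_A !mxE; apply: eq_bigr => u _; rewrite !mxE. Qed.

Let T_H_C (x : 'rV[k]_n) : T_H x <-> C *m x^T = 0.
Proof.
split=> [/T_H_lin Tx|Cx].
  by apply/colP => i; rewrite lin_C Tx coef0 mxE.
have Ax : A *m x^T = 0.
  have /submxP[D ->] : (A <= C)%MS by rewrite eq_maxrowsub.
  by rewrite -mulmxA Cx mulmx0.
apply/T_H_lin => e; have [e5|e5] := ltnP e 5; last by case: (identity_ge5 (x 0) e5).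
apply/polyP => m; rewrite coef0; have [mlt|mge] := ltnP m (12 * tau + 11).
  have := lin_A x (enum_rank (Ordinal e5, Ordinal mlt)).
  by rewrite /eqn enum_rankK Ax mxE.
rewrite coef_lin big1 // => u /eqP um.
by have := unk_lt u; rewrite um ltnNge mge.
Qed.

(** Invariance under this substitution expresses freedom from the variables in [E]; being invariance
    under a ring morphism, it passes through the linear and quadratic parts. *)
Let kill : n.-tuple {mpoly k[n]} := [tuple if u \in E then 0 else 'X_u | u < n].

Let kill_msupp p : p \mPo kill = p ->
  forall m, m \in msupp p -> forall v, v \in E -> m v = 0%N.
Proof.
move=> pk m mp v vE; apply/eqP/negPn/negP => mv; move: mp; rewrite mcoeff_msupp -pk.
rewrite comp_mpolyEX raddf_sum /= big1 ?eqxx // => m' _.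
rewrite comp_mpolyX mcoeffZ.
have [/existsP[u /andP[uE mu]]|/existsPn m'E] := boolP [exists u, (u \in E) && (m' u != 0%N)].
  rewrite (bigD1 u) //= tnth_map tnth_ord_tuple uE expr0n (negbTE mu) mul0r.
  by rewrite mcoeff0 mulr0.
rewrite (eq_bigr (fun u => 'X_u ^+ m' u)) => [|u _]; last first.
  have := m'E u; rewrite tnth_map tnth_ord_tuple; case: (u \in E) => //=.
  by rewrite negbK => /eqP ->; rewrite !expr0.
rewrite -mpolyXE_id mcoeffX; case: eqP => [mm|_]; last by rewrite mulr0.
by have := m'E v; rewrite vE mm mv.
Qed.

Let partial_solution K : exists W : 'I_n -> {mpoly k[n]},
  [/\ forall u, u \notin E -> W u = 'X_u, forall u, W u \mPo kill = W u
    & forall i : 'I_r, ((eqn (f i)).2 < K)%N ->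
      (lin W (eqn (f i)).1)`_(eqn (f i)).2 = (quad W (eqn (f i)).1)`_(eqn (f i)).2].
Proof.
elim: K => [|K [W [WX Wk IH]]].
  exists (fun u => if u \in E then 0 else 'X_u); split=> // u; first by move/negbTE ->.
  have [uE|uE] := boolP (u \in E); first by rewrite comp_mpoly0.
  by rewrite comp_mpolyXU -tnth_nth tnth_map tnth_ord_tuple (negbTE uE).
pose eps i := (lin W (eqn (f i)).1)`_(eqn (f i)).2 - (quad W (eqn (f i)).1)`_(eqn (f i)).2.
(* Only unknowns of weight [K] change, so the quadratic parts up to weight [K] and the equations of
   smaller weight are unaffected. *)
pose W' u := W u - (if (unk u).2 == K then \sum_i H u i *: eps i else 0).
have epsk i : eps i \mPo kill = eps i.
  have WkE : comp_mpoly kill \o W =1 W by move=> u; exact: Wk.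
  rewrite /eps comp_mpolyB; congr (_ - _); rewrite -coef_map ?map_lin ?map_quad.
    by rewrite (eq_lin WkE).
  by rewrite (eq_quad WkE).
have quadW' e m : (m <= K)%N -> (quad W' e)`_m = (quad W e)`_m.
  by move=> mK; apply: quad_agree => u um; rewrite /W'; case: eqP => [|_]; [lia|rewrite subr0].
exists W'; split=> [u uE|u|i iK].
- rewrite /W' WX // big1 ?if_same ?subr0 // => i _.
  by rewrite H_off // scale0r.
- rewrite /W' comp_mpolyB Wk; congr (_ - _); case: ifP => _; last by rewrite comp_mpoly0.
  by rewrite raddf_sum; apply: eq_bigr => i _; rewrite /= comp_mpolyZ epsk.
rewrite quadW' //; case: (ltngtP (eqn (f i)).2 K) => [ltK||eqK]; [|lia|].
  rewrite -(IH i ltK) [LHS]coef_lin [RHS]coef_lin; apply: eq_bigr => u /eqP ui; rewrite /W'.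
  by case: eqP => [|_]; [lia|rewrite subr0].
apply/eqP; rewrite -subr_eq0 linB coefB addrAC subr_eq0 -/(eps i); apply/eqP.
rewrite coef_lin (eq_bigr (fun u => \sum_j (C i u * H u j) *: eps j)) => [|u ui]; last first.
  rewrite (eqP ui) eqK eqxx mulr_sumr; apply: eq_bigr => j _.
  have -> : C i u = lsign k (eqn (f i)).1 (unk u).1 by rewrite !mxE ui.
  rewrite -scalerA -[RHS]mul_mpolyC; congr (_ * _).
  exact/esym/(lsign_morph (@mpolyC n k : {rmorphism k -> {mpoly k[n]}})).
rewrite (eq_bigl (fun u => ((unk u).2 == (eqn (f i)).2))) // exchange_big /=.
(* [C i u] is zero unless [u] has the weight of the equation [f i], so the sum restricted to that
   weight is a full entry of [C *m H], the identity matrix. *)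
transitivity (\sum_j (C *m H) i j *: eps j).
  rewrite C_H (bigD1 i) //= mxE eqxx scale1r big1 ?addr0 // => j ji.
  by rewrite mxE eq_sym (negbTE ji) scale0r.
apply: eq_bigr => j _; rewrite mxE scaler_suml [RHS]big_mkcond /=.
by apply: eq_bigr => u _; case: ifP => // ui; rewrite !mxE ui mul0r scale0r.
Qed.

(** Ensures that a dimension statement quantified over all eliminations is not vacuous. *)
Lemma elimination_exists : exists E B s, @is_elimination k tau E B s.
Proof.
have [W [WX Wk Wsol]] := partial_solution (12 * tau + 11).
exists E, B, [tuple W u | u < n]; split.
- move=> y; pose y' : 'rV[k]_n := \row_u (if u \in E then 0 else y 0 u).
  have [x Tx xy] : exists2 x : 'rV[k]_n, T_H x & forall u, u \notin E -> x 0 u = y 0 u.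
    exists (y'^T - H *m (C *m y'^T))^T.
      by apply/T_H_C; rewrite trmxK mulmxBr (mulmxA C H) C_H mul1mx subrr.
    move=> u uE; rewrite !mxE (negbTE uE) big1 ?subr0 // => i _.
    by rewrite H_off // mul0r.
  exists x; split=> // x' [Tx' x'y]; apply: trmx_inj.
  apply/eqP; rewrite -subr_eq0; apply/eqP; apply: off_col => [u uE|].
    by rewrite !mxE x'y // xy // subrr.
  by rewrite mulmxBr (T_H_C _).1 // (T_H_C _).1 // subr0.
- have eqn_inj : injective (fun i => eqn (f i)).
    move=> i j; rewrite /eqn => -[e1 e2]; apply: (maxrankfun_inj (A := A)).
    apply: enum_val_inj; move: e1 e2; rewrite -/f.
    case: (enum_val (f i)) => a b; case: (enum_val (f j)) => a' b' /= -> /val_inj ->.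
    by [].
  split; first by rewrite map_inj_uniq ?enum_uniq.
  by rewrite size_map size_enum_ord card_imset ?card_ord.
- move=> x Bx; apply/T_H_C/colP => i; rewrite lin_C mxE -pihomog1_rho.
  by apply: Bx; apply: (map_f (fun i => eqn (f i))); rewrite mem_enum.
- split=> [u uE|u m]; first by rewrite tnth_map tnth_ord_tuple WX.
  by rewrite tnth_map tnth_ord_tuple; apply: kill_msupp.
- move=> j /mapP[i _ ->]; rewrite (morph_rho (W := W)) ?Wsol ?subrr ?ltn_ord // => u.
  by rewrite /= comp_mpolyXU -tnth_nth tnth_map tnth_ord_tuple.
Qed.

End Elimination.

(** * Residues mod 6 *)

(* The point of [T_H] with the given eleven slices; [p] lists
   a1 = f6^(1), b1 = f9^(1), d2 = g7^(2), b2 = f10^(2), a3 = f6^(3), a4 = f8^(4),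
   d4 = g7^(4), a5 = f10^(5), u = f8^(6) - f9^(6), v = f6^(6) - 2 f9^(6), c6 = f9^(6). *)
Definition tangent_slice (R : comNzRingType) (p : nat -> R) (a : bool) (i j : nat) : R :=
  let a1 := p 0%N in let b1 := p 1%N in let d2 := p 2%N in let b2 := p 3%N in
  let a3 := p 4%N in let a4 := p 5%N in let d4 := p 6%N in let a5 := p 7%N in
  let u := p 8%N in let v := p 9%N in let c6 := p 10%N in
  if a then
    match (i, j) with
    | (4, 1)%N => a1 | (4, 2)%N => - d2 | (4, 4)%N => - d4 | (4, 5)%N => a5 | (4, 6)%N => v + c6
    | (5, 1)%N => a1 - b1 | (5, 6)%N => v + c6
    | (6, 1)%N => a1 - b1 | (6, 2)%N => d2 + b2 | (6, 4)%N => a4 | (6, 6)%N => u + v + c6 + c6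
    | (7, 1)%N => - b1 | (7, 2)%N => d2 | (7, 4)%N => d4 | (7, 5)%N => - a5
    | (8, 2)%N => d2 | (8, 3)%N => a3 | (8, 4)%N => d4 | (8, 5)%N => - a5 | (8, 6)%N => c6
    | _ => 0
    end
  else
    match (i, j) with
    | (6, 1)%N => a1 | (6, 3)%N => a3 | (6, 6)%N => v + c6 + c6
    | (8, 2)%N => d2 + b2 | (8, 4)%N => a4 | (8, 6)%N => u + c6
    | (9, 1)%N => b1 | (9, 3)%N => a3 | (9, 6)%N => c6
    | (10, 1)%N => b1 | (10, 2)%N => b2 | (10, 4)%N => a4 - d4 | (10, 5)%N => a5
    | (10, 6)%N => u + c6
    | _ => 0
    end.

(** The residue-[j] component of the right-hand side [e] at [tangent_slice p], divided by t^j. The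
    factor [T], which stands for t^6, marks the products whose residues add up to more than 6. *)
Definition quad_slice (R : comNzRingType) (T : R) (p : nat -> R) (e j : nat) : R :=
  let a1 := p 0%N in let b1 := p 1%N in let d2 := p 2%N in let b2 := p 3%N in
  let a3 := p 4%N in let a4 := p 5%N in let d4 := p 6%N in let a5 := p 7%N in
  let u := p 8%N in let v := p 9%N in let c6 := p 10%N in
  let d6 := v + c6 in let b6 := u + c6 in let a2 := d2 + b2 in let e1 := a1 - b1 in
  match (e, j) with
  | (0, 2)%N => a1 * b1 + T * (c6 * d2 - a3 * a5)
  | (0, 4)%N => a3 * e1 - T * (d4 * d6)
  | (0, 5)%N => a3 * d2 - a1 * d4 + T * (a5 * v)
  | (0, 6)%N => a5 * e1 - T * (c6 * d6)
  | (1, 1)%N => T * (a1 * u + a3 * a4 - b1 * v)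
  | (1, 3)%N => a1 * b2 + b1 * d2 + T * (a3 * b6)
  | (1, 5)%N => a1 * (a4 - d4) + a3 * a2 + b1 * d4
  | (1, 6)%N => a5 * e1 - T * (c6 * d6)
  | (2, 1)%N => T * (a1 * u + a3 * a4 - b1 * v)
  | (2, 2)%N => T * (a4 * d4 - c6 * a2) - b1 * e1
  | (2, 3)%N => T * (a3 * b6 - a4 * a5)
  | (2, 6)%N => a4 * d2 + T * (u * d6)
  | (3, 1)%N => T * (a4 * a3 - a5 * a2 - b1 * d6)
  | (3, 2)%N => - (T * (b6 * d2 + b2 * d6) + b1 * e1)
  | (3, 3)%N => - (T * (a4 * a5) + b1 * a2 + b2 * e1)
  | (3, 4)%N => T * (a4 * c6 - b6 * d4)
  | (4, 2)%N => b1 * b1 + T * (c6 * a2 - a5 * a3 - b6 * d2 - b2 * (d6 + c6))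
  | (4, 3)%N => - (T * (b6 * a3) + b1 * d2 + b2 * a1)
  | (4, 4)%N => T * (c6 * a4 - b6 * d4)
  | (4, 5)%N => T * (a5 * u) - b1 * d4 - b2 * a3
  | _ => 0
  end.

Lemma quad_of_tangent (R S : comNzRingType) (phi : {rmorphism R -> S}) (T : R) (t : S) p e :
  (e < 5)%N -> phi T = t ^+ 6 ->
  quad_of (fun a i j => t ^+ j * phi (tangent_slice p a i j)) e =
  \sum_(j <- iota 1 6) t ^+ j * phi (quad_slice T p e j).
Proof.
move=> e5 phiT; rewrite /= !big_cons big_nil addr0.
case: e e5 => [|[|[|[|[|//]]]]] _; rewrite /quad_of /= !big_cons !big_nil !addr0 /=.
all: rewrite ?(rmorphD, rmorphN, rmorphM, rmorph0) /= ?phiT; ring.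
Qed.

Section Slices.
Variables (k : fieldType) (tau : nat).
Local Notation n := (nunk tau).
Implicit Types (W : 'I_n -> k).

(* The partial polynomial of residue [j] is [t^j] times [slice] at [t^6]. *)
Definition slice W (a : bool) (i j : nat) : {poly k} :=
  \poly_(s < 2 * tau + 2) \sum_(u < n | unk u == (a, i, j + 6 * s)%N) W u.

Definition residue_sum (P : nat -> {poly k}) : {poly k} :=
  \sum_(j <- iota 1 6) 'X^j * (P j \Po 'X^6).

Lemma coef_shift6 (p : {poly k}) j m : (1 <= j <= 6)%N ->
  ('X^j * (p \Po 'X^6))`_m =
  if [&& j <= m & m == j %[mod 6]]%N then p`_((m - j) %/ 6) else 0.
Proof.
move=> j6; rewrite coefXnM coef_comp_poly_Xn //; case: ltnP => //= jm.
by rewrite /dvdn eqn_mod_dvd.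
Qed.

Lemma coef_residue_sum P j s : (1 <= j <= 6)%N -> (residue_sum P)`_(j + 6 * s) = (P j)`_s.
Proof.
move=> j6; have ji : j \in iota 1 6 by rewrite mem_iota; lia.
rewrite coef_sum (bigD1_seq j) ?iota_uniq //.
have modj : (j + 6 * s)%N == j %[mod 6] by apply/eqP; lia.
rewrite coef_shift6 // leq_addr modj addKn mulKn //.
rewrite big_seq_cond big1 /= ?addr0 // => i /andP[]; rewrite -[_ :: _]/(iota 1 6) mem_iota => i6 ij.
rewrite coef_shift6 //; case: ifP => // /andP[_ /eqP]; lia.
Qed.

Lemma slice_unknown W a i j s : (slice W a i j)`_s != 0 -> is_unknown tau (a, i, j + 6 * s)%N.
Proof.
rewrite coef_poly; case: ltnP => // _; rewrite ?eqxx //.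
apply: contraR => nu; rewrite big1 // => u /eqP uE.
by have := unkP u; rewrite uE (negbTE nu).
Qed.

Lemma is_unknown_slice a i j s : (1 <= j <= 6)%N -> is_unknown tau (a, i, j + 6 * s)%N =
  [&& ~~ normalized a i (j + 6 * s), j \in residues a i & j + 6 * s <= fdeg tau a i j]%N.
Proof.
move=> j6; rewrite /is_unknown addn_gt0 (leq_trans _ (andP j6).1) //=; congr (_ && _).
apply/hasP/andP => [[l la /andP[/eqP jl ls]]|[ja js]]; last first.
  by exists j => //; rewrite js andbT; apply/eqP; lia.
have := residues_range la => l6.
suff jlE : j = l by rewrite jlE in ls *.
by lia.
Qed.

Lemma coef_slice W a i j s : (slice W a i j)`_s = \sum_(u < n | unk u == (a, i, j + 6 * s)%N) W u.
Proof.
rewrite coef_poly; case: ltnP => // ge; rewrite big1 // => u /eqP uE.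
by have := unk_lt u; rewrite uE /=; lia.
Qed.

Lemma part_slice W a i j : (1 <= j <= 6)%N -> part W a i j = 'X^j * (slice W a i j \Po 'X^6).
Proof.
move=> j6; apply/polyP => m; rewrite coef_shift6 // coef_part.
case: (boolP (m == j %[mod 6])) => mj; last by rewrite andbF big1.
rewrite andbT; case: leqP => jm; last first.
  by rewrite big1 // => u /andP[_ /eqP um]; have := unk_gt0 u; rewrite um; lia.
rewrite coef_slice; apply: eq_bigl => u; rewrite -xpair_eqE -surjective_pairing.
by congr (_ == (_, _)); lia.
Qed.

Lemma full_slice W a i : full W a i = residue_sum (slice W a i).
Proof.
rewrite /full /residue_sum (eq_big_seq (fun j => 'X^j * (slice W a i j \Po 'X^6))); last first.
  by move=> j /residues_range ?; rewrite part_slice.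
rewrite [RHS](bigID (mem (residues a i))) /= [X in _ = _ + X]big1_seq ?addr0 => [|j]; last first.
  case/andP => ja; rewrite -[_ :: _]/(iota 1 6) mem_iota => j6.
  rewrite (_ : slice _ _ _ _ = 0) ?comp_poly0 ?mulr0 //.
  apply/polyP => s; rewrite coef0; apply: contraNeq ja => /slice_unknown.
  by rewrite is_unknown_slice => [/and3P[]//|]; lia.
rewrite -[RHS]big_filter; apply: perm_big; apply: uniq_perm; rewrite ?filter_uniq ?iota_uniq //.
  by case: a; do 11?[case: i => [//|i]].
move=> j; rewrite mem_filter -[_ :: _]/(iota 1 6) mem_iota.
by case: (boolP (j \in _)) => //= /residues_range.
Qed.

Lemma residue_sumD P Q : residue_sum P + residue_sum Q = residue_sum (fun j => P j + Q j).
Proof. by rewrite -big_split; apply: eq_bigr => j _; rewrite comp_polyD mulrDr. Qed.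

Lemma residue_sumN P : - residue_sum P = residue_sum (fun j => - P j).
Proof. by rewrite -sumrN; apply: eq_bigr => j _; rewrite raddfN mulrN. Qed.

Definition lin_slice (S : bool -> nat -> nat -> {poly k}) (e j : nat) : {poly k} :=
  nth 0 [:: S G 4%N j - S F 6%N j + S G 8%N j; S G 5%N j - S F 6%N j + S F 9%N j;
            S G 6%N j - S F 6%N j - S F 8%N j + S F 9%N j;
            S G 7%N j - S F 8%N j + S F 10%N j;
            S G 8%N j - S F 8%N j - S F 9%N j + S F 10%N j] e.

Lemma lin_slices W e : (e < 5)%N -> lin W e = residue_sum (lin_slice (slice W) e).
Proof.
by case: e => [|[|[|[|[|//]]]]] _; rewrite /lin /= !full_slice ?(residue_sumN, residue_sumD).
Qed.

Lemma quad_slices W p e : (e < 5)%N ->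
  (forall a i j, (1 <= j <= 6)%N -> slice W a i j = tangent_slice p a i j) ->
  quad W e = residue_sum (quad_slice 'X p e).
Proof.
move=> e5 Wp; rewrite -[RHS](quad_of_tangent (phi := comp_poly 'X^6)) //=; last first.
  by rewrite comp_polyX.
have partE a i j : (1 <= j <= 6)%N -> part W a i j = 'X^j * (tangent_slice p a i j \Po 'X^6).
  by move=> j6; rewrite part_slice // Wp.
by case: e e5 => [|[|[|[|[|//]]]]] _; rewrite /quad /quad_of /= !big_cons !big_nil !partE.
Qed.

End Slices.

Lemma eq_of_sub0 (V : zmodType) (x y z : V) : x - y = z -> z = 0 -> x = y.
Proof. by move=> <- /eqP; rewrite subr_eq0 => /eqP. Qed.

Lemma size_mulX_leS (k : fieldType) (p : {poly k}) s :
  (size ('X * p)%R <= s.+1)%N -> (size p <= s)%N.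
Proof.
by have [->|p0] := eqVneq p 0; rewrite ?size_poly0 // mulrC size_mulX.
Qed.

Lemma size_subr_le (k : fieldType) (p q : {poly k}) s :
  (size p <= s)%N -> (size q <= s)%N -> (size (p - q)%R <= s)%N.
Proof.
by move=> ps qs; rewrite (leq_trans (size_polyD _ _)) // size_polyN geq_max ps.
Qed.

Lemma size_addr_le (k : fieldType) (p q : {poly k}) s :
  (size p <= s)%N -> (size q <= s)%N -> (size (p + q)%R <= s)%N.
Proof. by move=> ps qs; rewrite (leq_trans (size_polyD _ _)) // geq_max ps. Qed.

Lemma size_mulr_leS (k : fieldType) (p q : {poly k}) s t :
  (size p <= s.+1)%N -> (size q <= t)%N -> (size (p * q)%R <= s + t)%N.
Proof. by move=> ps qt; apply: leq_trans (size_polyMleq _ _) _; lia. Qed.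

Lemma size_mulX_le (k : fieldType) (p : {poly k}) s :
  (size p <= s)%N -> (size ('X * p)%R <= s.+1)%N.
Proof. by move=> ps; apply: leq_trans (size_polyMleq _ _) _; rewrite size_polyX. Qed.

(** The five three-term relations of Gr(2,5), up to signs, with the ten coordinates in the order of
    the tangent parameters. Each coordinate occurs in three of them. *)
Definition pluecker (R : comNzRingType) (q : nat -> R) (m : nat) : R :=
  nth 0 [:: q 0%N * q 8%N + q 4%N * q 5%N - q 1%N * q 9%N;
            q 5%N * q 6%N + q 8%N * q 2%N + q 3%N * q 9%N;
            q 5%N * q 7%N + q 1%N * q 2%N + q 3%N * q 0%N;
            q 4%N * q 2%N - q 0%N * q 6%N + q 7%N * q 9%N;
            q 7%N * q 8%N - q 1%N * q 6%N - q 3%N * q 4%N] m.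

(** * Tangent vectors that extend to second order: necessary conditions *)

Section Cone.
Variables (k : fieldType) (tau : nat).
Hypothesis tau_gt0 : (0 < tau)%N.
Local Notation n := (nunk tau).

(* Shifting a5 aligns all the terms of the quadrics. *)
Definition shift7 (p : nat -> {poly k}) (l : nat) : {poly k} :=
  if l == 7%N then 'X * p l else p l.

(* The conditions at 0 come from the normalization of g_41, g_42 and g_46, those
   on degrees from the shorter formal degrees of g_4^(5), g_4^(6) and g_5^(6). *)
Record cone_params (p : nat -> {poly k}) : Prop := ConeParams {
  cone_size : forall l, (l <= 10)%N -> (size (p l) <= tau.+1)%N;
  cone_size7 : (size (p 7%N) <= tau)%N;
  cone_size9 : (size (p 9%N + p 10%N)%R <= tau)%N;
  cone_zero0 : (p 0%N)`_0 = 0;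
  cone_zero2 : (p 2%N)`_0 = 0;
  cone_zero9 : (p 9%N + p 10%N)`_0 = 0;
  cone_pluecker : forall m, (size (pluecker (shift7 p) m) <= tau.+1)%N }.

Definition params (S : bool -> nat -> nat -> {poly k}) (l : nat) : {poly k} :=
  nth 0 [:: S F 6%N 1%N; S F 9%N 1%N; S G 7%N 2%N; S F 10%N 2%N; S F 6%N 3%N; S F 8%N 4%N;
    S G 7%N 4%N; S F 10%N 5%N; S F 8%N 6%N - S F 9%N 6%N;
    S F 6%N 6%N - S F 9%N 6%N - S F 9%N 6%N; S F 9%N 6%N] l.

Lemma slice_eq0 (W : 'I_n -> k) a i j : (1 <= j <= 6)%N -> j \notin residues a i ->
  slice W a i j = 0.
Proof.
move=> j6 ja; apply/polyP => s; rewrite coef0; apply: contraNeq ja => /slice_unknown.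
by rewrite is_unknown_slice // => /and3P[].
Qed.

Lemma size_slice (W : 'I_n -> k) a i j s : (1 <= j <= 6)%N ->
  (j \in residues a i) ==> (fdeg tau a i j < j + 6 * s)%N ->
  (size (slice W a i j) <= s)%N.
Proof.
move=> j6 /implyP js; apply/leq_sizeP => l sl; apply/eqP; apply/negPn/negP.
by move/slice_unknown; rewrite is_unknown_slice // => /and3P[_ /js]; lia.
Qed.

Lemma lin_slice_eq (W W' : 'I_n -> k) : (forall e, lin W e = quad W' e) ->
  forall P, (forall e, (e < 5)%N -> quad W' e = residue_sum (P e)) ->
  forall e j, (e < 5)%N -> (1 <= j <= 6)%N -> lin_slice (slice W) e j = P e j.
Proof.
move=> lq P qP e j e5 j6; apply/polyP => s.
rewrite -(coef_residue_sum (lin_slice (slice W) e) s j6) -lin_slices // lq qP //.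
by rewrite coef_residue_sum.
Qed.

Lemma tangent_slices (x : 'rV[k]_n) : T_H x -> forall a i j, (1 <= j <= 6)%N ->
  slice (x 0) a i j = tangent_slice (params (slice (x 0))) a i j.
Proof.
move/T_H_lin => Lx; set S := slice (x 0).
have L e j : (e < 5)%N -> (1 <= j <= 6)%N -> lin_slice S e j = 0.
  move=> e5 j6; apply/polyP => s.
  by rewrite -(coef_residue_sum (lin_slice S e) s j6) -lin_slices // Lx !coef0.
have Z a i j : (1 <= j <= 6)%N -> j \notin residues a i -> S a i j = 0.
  exact: slice_eq0.
have g8 j : (1 <= j <= 6)%N -> S G 8%N j = S F 8%N j + S F 9%N j - S F 10%N j.
  by move=> j6; apply: eq_of_sub0 (L 4%N j isT j6); rewrite /lin_slice /=; ring.
have g7 j : (1 <= j <= 6)%N -> S G 7%N j = S F 8%N j - S F 10%N j.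
  by move=> j6; apply: eq_of_sub0 (L 3%N j isT j6); rewrite /lin_slice /=; ring.
have g6 j : (1 <= j <= 6)%N -> S G 6%N j = S F 6%N j + S F 8%N j - S F 9%N j.
  by move=> j6; apply: eq_of_sub0 (L 2%N j isT j6); rewrite /lin_slice /=; ring.
have g5 j : (1 <= j <= 6)%N -> S G 5%N j = S F 6%N j - S F 9%N j.
  by move=> j6; apply: eq_of_sub0 (L 1%N j isT j6); rewrite /lin_slice /=; ring.
have g4 j : (1 <= j <= 6)%N ->
    S G 4%N j = S F 6%N j - S F 8%N j - S F 9%N j + S F 10%N j.
  move=> j6; apply: eq_of_sub0 (L 0%N j isT j6).
  by rewrite /lin_slice /= g8 //; ring.
(* Once the g's are expressed by the f's, each partial polynomial missing from the lists forces a
   linear relation among the f's; here g_8^(1) is missing. *)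
have f1 : S F 10%N 1%N = S F 9%N 1%N.
  by have := g8 1%N isT; rewrite !(Z _ 8%N) // add0r => /esym/eqP; rewrite subr_eq0 => /eqP.
have f3 : S F 9%N 3%N = S F 6%N 3%N.
  have := g4 3%N isT; rewrite (Z _ 4%N) // (Z _ 8%N) // (Z _ 10%N) // addr0 subr0.
  by move/esym/eqP; rewrite subr_eq0 => /eqP.
have f4 : S F 6%N 4%N = 0.
  by have := g5 4%N isT; rewrite (Z _ 5%N) // (Z _ 9%N) // subr0.
have f5 : S F 8%N 5%N = 0.
  by have := g6 5%N isT; rewrite (Z G 6%N) // (Z F 6%N) // (Z _ 9%N) // subr0 add0r.
have f6 : S F 10%N 6%N = S F 8%N 6%N.
  by have := g7 6%N isT; rewrite (Z _ 7%N) // => /esym/eqP; rewrite subr_eq0 => /eqP.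
have Ftab i j : (1 <= j <= 6)%N -> S F i j = tangent_slice (params S) F i j.
  move=> j6; case: (boolP (j \in residues F i)) => ji; last first.
    rewrite Z //; move: ji j6.
    by do 11?[case: i => [//|i]]; do 7?[case: j => [//|j]].
  move: ji j6; do 11?[case: i => [//|i]]; do 7?[case: j => [//|j]] => //= _ _;
    rewrite /params /= ?f1 ?f3 ?f4 ?f5 ?f6 ?g7 //; ring.
move=> [] i j j6; last exact: Ftab.
case: (boolP (j \in residues G i)) => ji; last first.
  rewrite Z //; move: ji j6.
  by do 11?[case: i => [//|i]]; do 7?[case: j => [//|j]].
move: ji j6; do 11?[case: i => [//|i]]; do 7?[case: j => [//|j]] => //= _ _;
  rewrite ?g4 ?g5 ?g6 ?g7 ?g8 // ?Ftab //=; ring.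
Qed.

(** The quadratic slices equal linear combinations of the slices of [y] and inherit their formal
    degrees. Conditions arise from combinations in which no partial polynomial of formal degree
    [i + 12 * tau] is left. *)
Lemma Q_cone_params (x y : 'rV[k]_n) : T_H x -> (forall e, lin (y 0) e = quad (x 0) e) ->
  cone_params (params (slice (x 0))).
Proof.
move=> Tx; set S := slice (x 0); set p := params S => Ly.
have tab a i j : (1 <= j <= 6)%N -> S a i j = tangent_slice p a i j.
  exact: tangent_slices.
have sz a i j s : (1 <= j <= 6)%N -> (j \in residues a i) ==> (fdeg tau a i j < j + 6 * s)%N ->
  (size (S a i j) <= s)%N by exact: size_slice.
have zero j : (1 <= j <= 6)%N -> normalized G 4%N j -> (S G 4%N j)`_0 = 0.
  move=> j6 nj; apply/eqP/negPn/negP => /slice_unknown.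
  by rewrite is_unknown_slice // muln0 addn0 nj.
have s0 : (size (p 0%N) <= tau.+1)%N by apply: sz => //=; lia.
have s2 : (size (p 2%N) <= tau.+1)%N by apply: sz => //=; lia.
have s10 : (size (p 10%N) <= tau.+1)%N by apply: sz => //=; lia.
(* The formal degree of f_9^(1) is too large by 6, one power of T; the bound comes from g_5^(1) = a1
   - b1. Likewise b2 is bounded through g_6^(2) = d2 + b2. *)
have s1 : (size (p 1%N) <= tau.+1)%N.
  rewrite (_ : p 1%N = p 0%N - S G 5%N 1%N); last by rewrite tab //=; ring.
  by apply: size_subr_le => //; apply: sz => //=; lia.
have s3 : (size (p 3%N) <= tau.+1)%N.
  rewrite (_ : p 3%N = S G 6%N 2%N - p 2%N); last by rewrite tab //=; ring.
  by apply: size_subr_le => //; apply: sz => //=; lia.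
have s7 : (size (p 7%N) <= tau)%N.
  rewrite (_ : p 7%N = S G 4%N 5%N); last by rewrite tab.
  by apply: sz => //=; lia.
have s9' : (size (p 9%N + p 10%N)%R <= tau)%N.
  rewrite (_ : p 9%N + p 10%N = S G 4%N 6%N); last by rewrite tab.
  by apply: sz => //=; lia.
split=> //.
- move=> l; do 11?[case: l => [|l]] => // _.
  + by apply: sz => //=; lia.
  + by apply: sz => //=; lia.
  + by apply: sz => //=; lia.
  + exact: leqW.
  + by apply: size_subr_le => //; apply: sz => //=; lia.
  + rewrite (_ : p 9%N = (p 9%N + p 10%N) - p 10%N); last by ring.
    by apply: size_subr_le => //; apply: leqW.
- by rewrite (_ : p 0%N = S G 4%N 1%N) ?zero // tab.
- have -> : p 2%N = - S G 4%N 2%N by rewrite tab //= opprK.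
  by rewrite coefN zero // oppr0.
- by rewrite (_ : p 9%N + p 10%N = S G 4%N 6%N) ?zero // tab.
have L := lin_slice_eq Ly (fun e e5 => quad_slices e5 tab).
set Y := slice (y 0) in L *.
have szy a i j s : (1 <= j <= 6)%N -> (j \in residues a i) ==> (fdeg tau a i j < j + 6 * s)%N ->
  (size (Y a i j) <= s)%N by exact: size_slice.
move=> m; do 5?[case: m => [|m]].
- apply: size_mulX_leS; rewrite (_ : 'X * _ = quad_slice 'X p 1%N 1%N) // -L //.
  by apply: size_addr_le; [apply: size_subr_le|]; apply: szy => //=; lia.
(* Subtracting the fourth identity from the third cancels f_8^(2), whose formal degree 8 + 12 tau
   would spoil the bound. *)
- apply: size_mulX_leS; rewrite (_ : 'X * _ = quad_slice 'X p 2%N 2%N - quad_slice 'X p 3%N 2%N).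
    rewrite -!L // /lin_slice /= (_ : _ - _ = Y G 6%N 2%N - Y F 6%N 2%N
      + Y F 9%N 2%N - Y G 7%N 2%N - Y F 10%N 2%N); last by ring.
    by do 2![apply: size_subr_le; last by apply: szy => //=; lia];
      apply: size_addr_le; [apply: size_subr_le|]; apply: szy => //=; lia.
  by rewrite /pluecker /shift7 /quad_slice /=; ring.
- rewrite (_ : pluecker _ _ = - quad_slice 'X p 3%N 3%N); last first.
    by rewrite /pluecker /shift7 /quad_slice /=; ring.
  rewrite size_polyN -L //.
  by apply: size_addr_le; [apply: size_subr_le|]; apply: szy => //=; lia.
- rewrite (_ : pluecker _ _ = quad_slice 'X p 0%N 5%N); last first.
    by rewrite /pluecker /shift7 /quad_slice /=; ring.
  rewrite -L //.
  by apply: size_addr_le; [apply: size_subr_le|]; apply: szy => //=; lia.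
- rewrite (_ : pluecker _ _ = quad_slice 'X p 4%N 5%N); last first.
    by rewrite /pluecker /shift7 /quad_slice /=; ring.
  rewrite -L //.
  by apply: size_addr_le; [apply: size_subr_le; [apply: size_subr_le|]|]; apply: szy => //=; lia.
- by rewrite /pluecker nth_default // size_poly0.
Qed.

End Cone.

(** * Points with prescribed slices: the conditions are sufficient *)

Section ConePoint.
Variables (k : fieldType) (tau : nat).
Local Notation n := (nunk tau).
Implicit Types S : bool -> nat -> nat -> {poly k}.

Definition point_of S : 'rV[k]_n :=
  \row_u (let: (a, i, r) := unk u in (S a i (r.-1 %% 6).+1)`_(r.-1 %/ 6)).

(** These conditions make [S] the slices of an actual point. A slice of size at most [b] has
    exponents up to [j + 6 * (b - 1)], whence the [+ 6] on the right. *)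
Definition supported S : Prop :=
  [/\ (S G 4%N 1%N)`_0 = 0, (S G 4%N 2%N)`_0 = 0, (S G 4%N 6%N)`_0 = 0
    & forall a i j, (1 <= j <= 6)%N -> S a i j = 0 \/
        exists2 b, (size (S a i j) <= b)%N
          & (j \in residues a i) && (j + 6 * b <= fdeg tau a i j + 6)%N].

Lemma supported_unknown S a i j s : supported S -> (1 <= j <= 6)%N ->
  (S a i j)`_s != 0 -> is_unknown tau (a, i, j + 6 * s)%N.
Proof.
move=> [z1 z2 z6 sup] j6 nz; rewrite is_unknown_slice //.
case: (sup a i j j6) => [S0|[b Sb /andP[-> jb]]]; first by rewrite S0 coef0 eqxx in nz.
have sb : (s < b)%N by rewrite ltnNge; apply: contra nz => /(leq_trans Sb)/leq_sizeP ->.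
apply/andP; split; last by rewrite /=; lia.
apply/negP => /and3P[aE /eqP iE]; rewrite !inE => r.
suff : S a i j = S G 4%N j /\ s = 0%N /\ (j = 1 \/ j = 2 \/ j = 6)%N.
  by case=> SE [s0 [|[|]] jE]; rewrite SE s0 jE ?(z1, z2, z6) eqxx in nz.
by rewrite iE; case: a aE {sup nz jb Sb iE} => // _; split=> //; lia.
Qed.

Lemma slice_point_of S : supported S -> forall a i j, (1 <= j <= 6)%N ->
  slice (point_of S 0) a i j = S a i j.
Proof.
move=> sup a i j j6; apply/polyP => s; rewrite coef_slice.
have [S0|nz] := eqVneq (S a i j)`_s 0.
  rewrite S0 big1 // => u /eqP uE; rewrite mxE uE -[RHS]S0.
  by congr ((S a i _)`_ _); lia.
have [u uE] := unk_surj (supported_unknown sup j6 nz).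
rewrite (bigD1 u) ?uE //= mxE uE big1 ?addr0 => [|v /andP[/eqP vE vu]].
  by congr ((S a i _)`_ _); lia.
by case/eqP: vu; apply: unk_inj; rewrite vE.
Qed.

Lemma lin_eq_residues (W : 'I_n -> k) (S : bool -> nat -> nat -> {poly k}) P e :
  (forall a i j, (1 <= j <= 6)%N -> slice W a i j = S a i j) ->
  (forall j, (1 <= j <= 6)%N -> lin_slice S e j = P j) -> (e < 5)%N ->
  lin W e = residue_sum P.
Proof.
move=> WS SP e5; rewrite lin_slices //; apply: eq_big_seq => j.
rewrite mem_iota => j6; congr ('X^j * (_ \Po 'X^6)); rewrite -SP //.
by rewrite /lin_slice !WS.
Qed.

(* A second order solution above the tangent vector with parameters [p]. *)
Definition second_slice (p : nat -> {poly k}) (a : bool) (i j : nat) : {poly k} :=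
  let q := quad_slice 'X p in
  if a then
    match (i, j) with
    | (4, 4)%N => q 0%N 4%N
    | (5, 5)%N => q 1%N 5%N
    | (6, 3)%N => q 2%N 3%N - q 1%N 3%N | (6, 6)%N => q 2%N 6%N - q 0%N 6%N
    | (7, 1)%N => q 3%N 1%N - q 1%N 1%N | (7, 3)%N => q 3%N 3%N
    | (7, 5)%N => q 0%N 5%N - q 4%N 5%N
    | (8, 2)%N => q 0%N 2%N | (8, 5)%N => q 0%N 5%N
    | _ => 0
    end
  else
    match (i, j) with
    | (6, 6)%N => - q 0%N 6%N
    | (8, 2)%N => - q 2%N 2%N
    | (9, 1)%N => q 1%N 1%N | (9, 3)%N => q 1%N 3%N
    | (10, 1)%N => q 1%N 1%N | (10, 2)%N => q 3%N 2%N - q 2%N 2%N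
    | (10, 4)%N => q 3%N 4%N | (10, 5)%N => q 4%N 5%N - q 0%N 5%N
    | _ => 0
    end.

Hypothesis tau_gt0 : (0 < tau)%N.

Lemma tangent_supported p : cone_params tau p -> supported (tangent_slice p).
Proof.
case=> sz s7 s9 z0 z2 z9 _; split; rewrite /= ?coefN ?z0 ?z2 ?oppr0 ?z9 //.
have s : forall l, (l <= 10)%N -> (size (p l) <= tau.+1)%N by [].
move=> a i j j6; case: (boolP (j \in residues a i)) => ji; last first.
  left; move: ji j6.
  by case: a; do 11?[case: i => [//|i]]; do 7?[case: j => [//|j]].
right; exists (if (a && ((i == 4) && (5 <= j) || (i == 5) && (j == 6)))%N then tau else tau.+1).
  move: ji j6; case: a; do 11?[case: i => [//|i]]; do 7?[case: j => [//|j]] => // _ _ /=.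
  all: rewrite ?size_polyN ?size_poly0 ?s ?s7 ?s9 //.
  all: try exact: leqW.
  all: rewrite -?addrA; repeat first [apply: size_subr_le | apply: size_addr_le];
    rewrite ?size_polyN ?s //; try exact: leqW.
by move: ji j6; case: a; do 11?[case: i => [//|i]]; do 7?[case: j => [//|j]] => //= _ _; lia.
Qed.

(** The quadrics placed in short partial polynomials are Pluecker forms, bounded by hypothesis; the
    others go into partial polynomials of formal degree [i + 12 * tau], where the trivial bound on a
    product suffices. *)
Lemma second_supported p : cone_params tau p -> supported (second_slice p).
Proof.
case=> sz s7 s9 _ _ _ sp; split; rewrite /second_slice /= ?coef0 //.
have s : forall l, (l <= 10)%N -> (size (p l) <= tau.+1)%N by [].
have X1 : (size (quad_slice 'X p 1%N 1%N) <= tau.+2)%N.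
  exact: size_mulX_le (sp 0%N).
have X2 : (size (quad_slice 'X p 3%N 2%N - quad_slice 'X p 2%N 2%N)%R <= tau.+2)%N.
  rewrite (_ : _ - _ = - ('X * pluecker (shift7 p) 1%N)) ?size_polyN.
    exact: size_mulX_le (sp 1%N).
  by rewrite /pluecker /shift7 /quad_slice /=; ring.
have X3 : (size (quad_slice 'X p 3%N 3%N) <= tau.+1)%N.
  rewrite (_ : quad_slice _ _ _ _ = - pluecker (shift7 p) 2%N) ?size_polyN //.
  by rewrite /pluecker /shift7 /quad_slice /=; ring.
have X3' : (size (quad_slice 'X p 2%N 3%N - quad_slice 'X p 1%N 3%N)%R <= tau.+1)%N.
  rewrite (_ : _ - _ = - pluecker (shift7 p) 2%N) ?size_polyN //.
  by rewrite /pluecker /shift7 /quad_slice /=; ring.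
have X5 : (size (quad_slice 'X p 0%N 5%N) <= tau.+1)%N.
  rewrite (_ : quad_slice _ _ _ _ = pluecker (shift7 p) 3%N) //.
  by rewrite /pluecker /shift7 /quad_slice /=; ring.
have X5' : (size (quad_slice 'X p 4%N 5%N) <= tau.+1)%N.
  rewrite (_ : quad_slice _ _ _ _ = pluecker (shift7 p) 4%N) //.
  by rewrite /pluecker /shift7 /quad_slice /=; ring.
have m (u v : {poly k}) : (size u <= tau.+1)%N -> (size v <= tau.+1)%N ->
    (size (u * v)%R <= (2 * tau).+1)%N.
  by move=> su sv; apply: leq_trans (size_mulr_leS su sv) _; lia.
have Xm (u v : {poly k}) : (size u <= tau.+1)%N -> (size v <= tau.+1)%N ->
    (size (u * v)%R <= (2 * tau).+2)%N by move=> su sv; apply/leqW/m.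
(* [p 9 + p 10] is one shorter than the other parameters, which compensates the factor ['X]. *)
have md (u : {poly k}) : (size u <= tau.+1)%N ->
    (size ('X * (u * (p 9%N + p 10%N)))%R <= (2 * tau).+1)%N.
  by move=> su; apply: size_mulX_le; apply: leq_trans (size_mulr_leS su s9) _; lia.
have s79 : (size (p 9%N + p 10%N)%R <= tau.+1)%N by exact: leqW.
have s01 : (size (p 0%N - p 1%N)%R <= tau.+1)%N by apply: size_subr_le; apply: s.
have s23 : (size (p 2%N + p 3%N)%R <= tau.+1)%N by apply: size_addr_le; apply: s.
have s56 : (size (p 5%N - p 6%N)%R <= tau.+1)%N by apply: size_subr_le; apply: s.
have s8X : (size (p 8%N + p 10%N)%R <= tau.+1)%N by apply: size_addr_le; apply: s.
have le02 : (size (quad_slice 'X p 0%N 2%N) <= (2 * tau).+2)%N.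
  apply: size_addr_le; [apply: Xm|apply: size_mulX_le; apply: size_subr_le; apply: m];
    exact: s.
have le22 : (size (quad_slice 'X p 2%N 2%N) <= (2 * tau).+2)%N.
  by apply: size_subr_le; [apply: size_mulX_le; apply: size_subr_le; apply: m|apply: Xm];
    rewrite ?s.
have le13 : (size (quad_slice 'X p 1%N 3%N) <= (2 * tau).+2)%N.
  by apply: size_addr_le; [apply: size_addr_le; apply: Xm|apply: size_mulX_le; apply: m];
    rewrite ?s.
have le11 : (size (quad_slice 'X p 1%N 1%N) <= (2 * tau).+2)%N by apply: leq_trans X1 _; lia.
have le31 : (size (quad_slice 'X p 3%N 1%N) <= (2 * tau).+2)%N.
  by apply: size_mulX_le; apply: size_subr_le; [apply: size_subr_le|]; apply: m; rewrite ?s.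
have le34 : (size (quad_slice 'X p 3%N 4%N) <= (2 * tau).+2)%N.
  by apply: size_mulX_le; apply: size_subr_le; apply: m; rewrite ?s.
have le04 : (size (quad_slice 'X p 0%N 4%N) <= (2 * tau).+1)%N.
  by apply: size_subr_le; [apply: m|apply: md]; rewrite ?s.
have le15 : (size (quad_slice 'X p 1%N 5%N) <= (2 * tau).+1)%N.
  by apply: size_addr_le; [apply: size_addr_le|]; apply: m; rewrite ?s.
have le06 : (size (quad_slice 'X p 0%N 6%N) <= (2 * tau).+1)%N.
  by apply: size_subr_le; [apply: m|apply: md]; rewrite ?s.
have le26 : (size (quad_slice 'X p 2%N 6%N) <= (2 * tau).+1)%N.
  by apply: size_addr_le; [apply: m|apply: md]; rewrite ?s.
move=> a i j j6.
pose b := (match a, i, j with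
  | true, 4, 4 | true, 5, 5 | true, 6, 6 | false, 6, 6 => (2 * tau).+1
  | true, 6, 3 | true, 7, 3 | true, 7, 5 | true, 8, 5 | false, 10, 5 => tau.+1
  | false, 9, 1 | false, 10, 1 | false, 10, 2 => tau.+2
  | _, _, _ => (2 * tau).+2 end)%N.
case: a @b; do 11?[case: i => [|i]]; do 7?[case: j j6 => [|j] j6 //]; try by left.
all: move=> b; right; exists b; rewrite /b //=; try lia.
all: by [exact: X3 | rewrite size_polyN | apply: size_subr_le].
Qed.

Lemma cone_point p : cone_params tau p ->
  let x := point_of (tangent_slice p) in
  T_H x /\ exists y : 'rV[k]_n, forall e, lin (y 0) e = quad (x 0) e.
Proof.
move=> cp x; have xp := slice_point_of (tangent_supported cp).
have yp := slice_point_of (second_supported cp).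
split.
  apply/T_H_lin => e; have [e5|e5] := ltnP e 5; last by case: (identity_ge5 (x 0) e5).
  rewrite (lin_eq_residues (P := fun=> 0) xp) // => [|j j6].
    by rewrite /residue_sum big1 // => j _; rewrite comp_poly0 mulr0.
  case: e e5 => [|[|[|[|[|//]]]]] _; move: j6; do 7?[case: j => [//|j]] => // _;
    rewrite /lin_slice /=; ring.
exists (point_of (second_slice p)) => e.
have [e5|e5] := ltnP e 5; last first.
  have [_ ->] := identity_ge5 (x 0) e5.
  by case: (identity_ge5 (point_of (second_slice p) 0) e5).
rewrite (quad_slices e5 xp); apply: (lin_eq_residues yp _ e5) => j j6.
case: e e5 => [|[|[|[|[|//]]]]] _; move: j6; do 7?[case: j => [//|j]] => // _;
  rewrite /lin_slice /second_slice /quad_slice /=; ring.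
Qed.

End ConePoint.

(** * The bound from above *)

Section Reversal.
Variables (k : fieldType) (tau : nat).
Implicit Types A B : {poly k}.

(** The constant term is dropped: between factors of degree at most [tau], it cannot contribute to a
    coefficient above T^tau. *)
Definition rev_poly A : {poly k} := \poly_(e < tau) A`_(tau - e).

Lemma coef_rev A e : (rev_poly A)`_e = if (e < tau)%N then A`_(tau - e) else 0.
Proof. by rewrite coef_poly. Qed.

Lemma coef_revM A B e : (size A <= tau.+1)%N -> (size B <= tau.+1)%N -> (e < tau)%N ->
  (rev_poly A * rev_poly B)`_e = (A * B)`_(2 * tau - e).
Proof.
move=> sA sB et; rewrite !coefM.
rewrite -[RHS](big_mkord xpredT (fun i => A`_i * B`_(2 * tau - e - i))).
rewrite (big_cat_nat (n := tau - e)) //=; last by lia.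
rewrite [X in _ = X + _]big_nat [X in _ = X + _]big1 ?add0r => [|i i_lt]; last first.
  by rewrite [X in _ * X]nth_default ?mulr0 // (leq_trans sB) //; lia.
rewrite (big_cat_nat (n := tau.+1)) /=; [|lia|lia].
rewrite [X in _ = _ + X]big_nat [X in _ = _ + X]big1 ?addr0 => [|i i_lt]; last first.
  by rewrite [X in X * _]nth_default ?mul0r // (leq_trans sA) //; lia.
rewrite -[(tau - e)%N]add0n big_addn (_ : (tau.+1 - (tau - e))%N = e.+1); last by lia.
rewrite big_mkord (reindex_inj rev_ord_inj) /=; apply: eq_bigr => i _.
have := ltn_ord i; rewrite ltnS => ie; rewrite !coef_rev !ifT; [|lia|lia].
by congr (A`_ _ * B`_ _); lia.
Qed.

Lemma pluecker_rev (q : nat -> {poly k}) m e :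
  (forall l, (l < 10)%N -> (size (q l) <= tau.+1)%N) -> (e < tau)%N ->
  (pluecker (fun l => rev_poly (q l)) m)`_e = (pluecker q m)`_(2 * tau - e).
Proof.
move=> sq et; do 6?[case: m => [|m]]; rewrite /pluecker /= ?coef0 //.
all: by rewrite ?(coefD, coefN) !coef_revM ?sq.
Qed.

End Reversal.

(* The three coordinates paired with [v] in some Pluecker quadric. *)
Definition complement (v : nat) : seq nat :=
  nth [::] [:: [:: 8; 3; 6]; [:: 9; 2; 6]; [:: 8; 1; 4]; [:: 9; 0; 4]; [:: 5; 2; 3];
    [:: 4; 6; 7]; [:: 5; 0; 1]; [:: 5; 9; 8]; [:: 0; 2; 7]; [:: 1; 3; 7]]%N v.

Lemma complement_irrefl v : (v < 10)%N -> v \notin complement v.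
Proof. by do 10?[case: v => [//|v]]. Qed.

Lemma complement_lt v c : (v < 10)%N -> c \in complement v -> (c < 10)%N.
Proof.
move=> v10; have /allP all_lt : all (fun c => c < 10)%N (complement v).
  by do 10?[case: v v10 => [//|v] v10].
exact: all_lt.
Qed.

(** Each product [q v * q c] occurs in exactly one relation, whose other two terms avoid
    [complement v]; killing the complement therefore removes this product alone. The table lists
    that relation and the sign. *)
Lemma pluecker_solve v c : (v < 10)%N -> c \in complement v -> exists m (s : nat),
  forall (R : comNzRingType) (q : nat -> R), q v * q c = (-1) ^+ s *
    (pluecker q m - pluecker (fun l => if l \in complement v then 0 else q l) m).
Proof.
move=> v10; do 10?[case: v v10 => [|v] v10 //]; rewrite !inE => /or3P[] /eqP ->;
  [exists 0%N, 0%N|exists 2%N, 0%N|exists 3%N, 1%N|exists 0%N, 1%N|exists 2%N, 0%N|exists 4%N, 1%N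
  |exists 1%N, 0%N|exists 2%N, 0%N|exists 3%N, 0%N|exists 1%N, 0%N|exists 2%N, 0%N|exists 4%N, 1%N
  |exists 0%N, 0%N|exists 3%N, 0%N|exists 4%N, 1%N|exists 0%N, 0%N|exists 1%N, 0%N|exists 2%N, 0%N
  |exists 1%N, 0%N|exists 3%N, 1%N|exists 4%N, 1%N|exists 2%N, 0%N|exists 3%N, 0%N|exists 4%N, 0%N
  |exists 0%N, 0%N|exists 1%N, 0%N|exists 4%N, 0%N|exists 0%N, 1%N|exists 1%N, 0%N|exists 3%N, 0%N];
  move=> R q; rewrite /pluecker /=; ring.
Qed.

Section LocalizedParameters.
Variables (k : fieldType) (n d : nat) (Z : affine_set k n).
Variables (h : 'rV[k]_n -> k) (y : 'I_d -> 'rV[k]_n -> k).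
Hypothesis hP : exists q : {mpoly k[d]}, forall x, Z x -> h x = q.@[fun i => y i x].
Implicit Types q p : 'rV[k]_n -> nat -> {poly k}.

Lemma localized_pluecker q m : (forall i, (i < 10)%N -> localized_poly Z h y (q^~ i)) ->
  localized_poly Z h y (fun x => pluecker (q x) m).
Proof.
move=> lq; do 6?[case: m => [|m]]; rewrite /pluecker /=; try exact: localized_poly0.
all: by repeat first [exact: lq | apply: (localized_polyB hP)
  | apply: (localized_polyD hP) | apply: (localized_polyM hP)].
Qed.

Lemma localized_tangent p a i j :
  (forall l, (l <= 10)%N -> localized_poly Z h y (p^~ l)) ->
  localized_poly Z h y (fun x => tangent_slice (p x) a i j).
Proof.
move=> lp; case: a; do 11?[case: i => [|i]]; do 7?[case: j => [|j]]; rewrite /tangent_slice;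
  try exact: localized_poly0; try exact: lp;
  repeat first [exact: lp | apply: (localized_polyB hP) | apply: localized_polyN
    | apply: (localized_polyD hP)].
Qed.

End LocalizedParameters.

(** * Generators of the localized coordinate ring on a stratum *)

Section ChainBound.
Variables (k : fieldType) (tau : nat).
Hypothesis tau_gt0 : (0 < tau)%N.
Local Notation n := (nunk tau).
Implicit Types x : 'rV[k]_n.

Definition coords x (l : nat) : {poly k} := shift7 (params (slice (x 0))) l.

Definition jets x (l : nat) : {poly k} := rev_poly tau (coords x l).

Lemma polyfun_slice a i j s : polyfun (fun x => (slice (x 0) a i j)`_s).
Proof.
apply: (localized_ext (f := fun x => \sum_(u | unk u == (a, i, j + 6 * s)%N) x 0 u)).
  by move=> x _; rewrite coef_slice.
apply: (localized_sum (@polyfun1 k n)) => u _; exact: localized_gen.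
Qed.

Lemma polyfun_coords l s : polyfun (fun x => (coords x l)`_s).
Proof.
have pB f g : polyfun f -> polyfun g -> polyfun (fun x : 'rV[k]_n => f x - g x).
  exact: (localizedB (@polyfun1 k n)).
have pP s' : polyfun (fun x => (params (slice (x 0)) l)`_s').
  do 11?[case: l => [|l]]; rewrite /params /=; try exact: polyfun_slice.
  - apply: localized_ext (pB _ _ (polyfun_slice F 8 6 s') (polyfun_slice F 9 6 s')).
    by move=> x _; rewrite coefB.
  - apply: localized_ext (pB _ _ (pB _ _ (polyfun_slice F 6 6 s') (polyfun_slice F 9 6 s'))
      (polyfun_slice F 9 6 s')).
    by move=> x _; rewrite !coefB.
  - apply: localized_ext (localized_const _ _ _ 0) => x _.
    by rewrite nth_nil coef0.
rewrite /coords /shift7; case: eqP => // _; case: s => [|s].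
  apply: localized_ext (localized_const _ _ _ 0) => x _.
  by rewrite coefXM.
by apply: localized_ext (pP s) => x _; rewrite coefXM.
Qed.

Section Generators.
Variables (Z : affine_set k n) (h : 'rV[k]_n -> k) (d : nat) (y : 'I_d -> 'rV[k]_n -> k).
Hypothesis hP : exists q : {mpoly k[d]}, forall x, Z x -> h x = q.@[fun i => y i x].
Hypothesis Zcone : forall x, Z x -> T_H x /\ cone_params tau (params (slice (x 0))).

Let loc (f : 'rV[k]_n -> k) := localized Z h y f.
Let locp := localized_poly Z h y.

Let loc0 (f : 'rV[k]_n -> k) : (forall x, Z x -> f x = 0) -> loc f.
Proof. by move=> f0; apply: localized_ext (localized_const _ _ _ 0) => x /f0. Qed.

Let coords_size x l : Z x -> (l <= 10)%N -> (size (coords x l) <= tau.+1)%N.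
Proof.
case/Zcone => _ [sz s7 _ _ _ _ _] l10; rewrite /coords /shift7; case: eqP => [->|_].
  exact: size_mulX_le.
exact: sz.
Qed.

Let pluecker_jets x m e : Z x -> (e < tau)%N -> (pluecker (jets x) m)`_e = 0.
Proof.
move=> Zx et; rewrite pluecker_rev // => [|l l10]; last by apply: coords_size => //; lia.
have [_ [_ _ _ _ _ _ sp]] := Zcone Zx.
by rewrite nth_default // (leq_trans (sp m)) //; lia.
Qed.

(** The remaining coefficients are forced: the other constant terms vanish, and since v + c6 has no
    constant term and degree below [tau], the coefficients of c6 at 0 and [tau] are those of -v. *)
Lemma localized_coordinates :
  (forall l s, (l < 10)%N -> (0 < s <= tau)%N -> loc (fun x => (coords x l)`_s)) ->
  (forall l, l \in [:: 1; 3; 4; 5; 6; 8; 9]%N -> loc (fun x => (coords x l)`_0)) ->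
  (forall s, (0 < s < tau)%N -> loc (fun x => (coords x 10)`_s)) ->
  forall u, loc (fun x => x 0 u).
Proof.
move=> l1 l0 l10.
have coordsP l : (l < 10)%N -> locp (coords^~ l).
  move=> l_lt s; have [ts|st] := ltnP tau s.
    by apply: loc0 => x Zx; rewrite nth_default // (leq_trans (coords_size _ _)) // ltnW.
  have [s0|s0] := posnP s; last by apply: l1; rewrite ?s0.
  rewrite {}s0; case: (boolP (l \in [:: 1; 3; 4; 5; 6; 8; 9]%N)) => [|lN]; first exact: l0.
  apply: loc0 => x /Zcone[_ [_ _ _ z0 z2 _ _]].
  move: lN l_lt; rewrite /coords /shift7.
  by do 10?[case: l => [|l] //]; rewrite ?coefXM.
pose par l x := params (slice (x 0)) l.
have par_lt l : (l < 10)%N -> locp (par l).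
  move=> ll s; have [l7|l7] := eqVneq l 7%N; last first.
    apply: localized_ext (coordsP l ll s) => x _.
    by rewrite /coords /shift7 (negbTE l7).
  apply: localized_ext (coordsP 7%N isT s.+1) => x _.
  by rewrite /coords /shift7 /= coefXM l7.
have par10 : locp (par 10%N).
  move=> s; have [s_in|s_out] := boolP (0 < s < tau)%N; first exact: l10.
  have [st|st] := ltnP tau s.
    by apply: loc0 => x Zx; apply/nth_default/(leq_trans (coords_size Zx (leqnn 10))).
  apply: localized_ext (localizedN (par_lt 9%N isT s)) => x Zx.
  have [_ [_ _ s9 _ _ z9 _]] := Zcone Zx.
  apply/eqP; rewrite eq_sym -addr_eq0 addrC -coefD; apply/eqP.
  have [->|s0] := posnP s; first exact: z9.
  by apply: nth_default; rewrite (leq_trans s9) //; lia.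
have par_le l : (l <= 10)%N -> locp (par l).
  by rewrite leq_eqVlt => /orP[/eqP ->|/par_lt].
move=> u; case uE : (unk u) => [[a i] r].
pose j := (r.-1 %% 6).+1; pose s := (r.-1 %/ 6)%N.
have rE : r = (j + 6 * s)%N by have := unk_gt0 u; rewrite uE /= /j /s; lia.
apply: localized_ext (localized_tangent hP a i j par_le s) => x /Zcone[Tx _].
rewrite -tangent_slices // /j; last by lia.
rewrite coef_slice -rE (bigD1 u) ?uE //= big1 ?addr0 // => v /andP[/eqP vE vu].
by case/eqP: vu; apply: unk_inj; rewrite vE.
Qed.

(* Jets of order at least [o]: where the leading coefficient [h] of the
   coordinate [v] is invertible, the quadrics determine all but [o] coefficients
   of each of the three coordinates complementary to [v]. *)
Lemma localized_jets v o : (v < 10)%N -> (o < tau)%N ->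
  (forall x, Z x -> h x = (jets x v)`_o) ->
  (forall x l e, Z x -> (l < 10)%N -> (e < o)%N -> (jets x l)`_e = 0) ->
  (forall l e, (l < 10)%N -> l \notin complement v -> (o <= e < tau)%N ->
     loc (fun x => (jets x l)`_e)) ->
  (forall c e, c \in complement v -> (tau - o <= e < tau)%N -> loc (fun x => (jets x c)`_e)) ->
  forall l e, (l < 10)%N -> loc (fun x => (jets x l)`_e).
Proof.
move=> v10 ot hE low locN locC.
have big l e : (tau <= e)%N -> loc (fun x => (jets x l)`_e).
  by move=> te; apply: loc0 => x _; rewrite coef_rev ltnNge te.
have jetsN l : (l < 10)%N -> l \notin complement v -> locp (jets^~ l).
  move=> l10 lN e; have [eo|oe] := ltnP e o; first by apply: loc0 => x Zx; apply: low.
  have [et|te] := ltnP e tau; last exact: big.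
  by apply: locN => //; rewrite oe.
have vN : v \notin complement v by apply: complement_irrefl.
move=> l e l10; case: (boolP (l \in complement v)) => [lC|]; last by move/(jetsN l l10)/(_ e).
elim/ltn_ind: e => e IH.
have [eo|oe] := ltnP e o; first by apply: loc0 => x Zx; apply: low.
have [et|te] := ltnP e tau; last exact: big.
have [eto|toe] := ltnP e (tau - o); last by apply: locC => //; rewrite toe.
have [m [s solve]] := pluecker_solve v10 lC.
have lP' : locp (fun x => (-1) ^+ s *
    pluecker (fun l => if l \in complement v then 0 else jets x l) m).
  apply: (localized_polyM hP) => [s'|].
    exact: localized_const.
  have q' i : (i < 10)%N -> locp (fun x => if i \in complement v then 0 else jets x i).
    move=> i10; case: (boolP (i \in complement v)) => [_|/(jetsN i i10) //].
    exact: localized_poly0.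
  exact: (localized_pluecker hP m q').
(* Coefficient [o + e] of the relation is [h] times the wanted coefficient plus terms already
   localized. The relation is available because [o + e < tau], so the last [o] coefficients have to
   come from [locC]. *)
apply: localized_divh.
apply: (localized_ext (f := fun x => - ((-1) ^+ s *
    pluecker (fun l => if l \in complement v then 0 else jets x l) m)`_(o + e)
    - \sum_(i < (o + e).+1 | (o < i)%N) (jets x v)`_i * (jets x l)`_(o + e - i))); last first.
  apply: (localizedB hP); first exact: (localizedN (lP' _)).
  apply: (localized_sum hP) => i oi; apply: localizedM; first exact: jetsN.
  by apply: IH; have := ltn_ord i; lia.
move=> x Zx; have /(congr1 (fun p : {poly k} => p`_(o + e))) := solve _ (jets x).
rewrite mulrBr coefB.
have -> : ((-1) ^+ s * pluecker (jets x) m)`_(o + e) = 0.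
  have pz : (pluecker (jets x) m)`_(o + e) = 0 by apply: pluecker_jets => //; lia.
  by rewrite -signr_odd; case: (odd s); rewrite ?mulN1r ?mul1r ?coefN pz ?oppr0.
rewrite sub0r => <-; rewrite coefM.
have oi : (o < (o + e).+1)%N by lia.
rewrite (bigID (fun i : 'I__ => (o < i)%N)) /= addrC addrK.
rewrite (bigD1 (Ordinal oi)) ?ltnn //= big1 ?addr0 => [|i /andP[io]].
  by rewrite -hE // addKn.
rewrite -val_eqE /= => io'; rewrite low ?mul0r //; lia.
Qed.

End Generators.
End ChainBound.

Section ChainBoundMain.
Variables (k : fieldType) (tau : nat).
Hypothesis tau_gt0 : (0 < tau)%N.
Local Notation n := (nunk tau).
Implicit Types (x : 'rV[k]_n) (Z : affine_set k n).

(* A label [(l, s)] stands for the coefficient of [T^s] in the [l]-th coordinate. *)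
Definition label_fun (labels : seq (nat * nat)) (i : nat) x : k :=
  (coords x (nth (0, 0)%N labels i).1)`_(nth (0, 0)%N labels i).2.

Lemma index_label labels d c : (size labels <= d)%N -> c \in labels ->
  exists i : 'I_d, forall x, label_fun labels i x = (coords x c.1)`_c.2.
Proof.
move=> sd cl; have cd : (index c labels < d)%N by rewrite (leq_trans _ sd) // index_mem.
by exists (Ordinal cd) => x; rewrite /label_fun nth_index.
Qed.

Lemma localized_label labels d c Z h : (size labels <= d)%N -> c \in labels ->
  localized Z h (fun i : 'I_d => label_fun labels i) (fun x => (coords x c.1)`_c.2).
Proof.
move=> sd cl; have [i iE] := index_label sd cl.
by apply: localized_ext (localized_gen _ _ _ i) => x _; rewrite iE.
Qed.

Definition base_labels : seq (nat * nat) :=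
  [seq (10, s)%N | s <- iota 1 (tau - 1)] ++ [seq (l, 0)%N | l <- [:: 1; 3; 4; 5; 6; 8; 9]%N].

Definition jet_labels v o : seq (nat * nat) := base_labels ++
  ([seq (l, s) | l <- [seq l <- iota 0 10 | l \notin complement v], s <- iota 1 (tau - o)] ++
   [seq (c, s) | c <- complement v, s <- iota 1 o]).

Lemma size_base_labels : size base_labels = (tau + 6)%N.
Proof. by rewrite size_cat !size_map size_iota /=; lia. Qed.

(** Besides the base labels there are seven coordinates with [tau - o] coefficients and three with
    [o], in all [7 * tau - 4 * o]. *)
Lemma size_jet_labels v o : (v < 10)%N -> (o <= tau)%N ->
  (size (jet_labels v o) <= 8 * tau + 6)%N.
Proof.
move=> v10 ot; rewrite size_cat size_base_labels size_cat !size_allpairs !size_iota.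
suff [-> ->] : (size [seq l <- iota 0 10 | l \notin complement v] = 7 /\ size (complement v) = 3)%N.
  by lia.
by do 10?[case: v v10 => [//|v] v10].
Qed.

(** The order is taken over the whole of [Z]: [o] is the least index at which some jet coefficient
    is not identically zero on [Z], so a single localization serves all of [Z]. *)
Lemma order_exists Z :
  (forall x l e, Z x -> (l < 10)%N -> (jets x l)`_e = 0) \/
  exists v o, [/\ (v < 10)%N, (o < tau)%N, ~ (forall x, Z x -> (jets x v)`_o = 0)
    & forall x l e, Z x -> (l < 10)%N -> (e < o)%N -> (jets x l)`_e = 0].
Proof.
apply: NNPP => /not_or_and[nz nex]; apply: nz => x l e; move: e x l.
elim/ltn_ind => e IH x l Zx l10; apply: NNPP => nz; apply: nex; exists l, e; split=> //.
- by rewrite ltnNge; apply/negP => te; apply: nz; rewrite coef_rev ltnNge te.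
- by move=> z; apply: nz; apply: z.
- by move=> x' l' e' Zx' l'10 e'e; apply: IH.
Qed.

Lemma second_order_chain_le (V : affine_set k n) e (Z : nat -> affine_set k n) :
  (forall x, V x -> T_H x /\ exists y : 'rV[k]_n, forall e, lin (y 0) e = quad (x 0) e) ->
  irreducible_chain V e Z -> (e <= 8 * tau + 6)%N.
Proof.
move=> HV chZ; have [_ irrZ ZV] := chZ.1 e (leqnn e).
have Zcone x : Z e x -> T_H x /\ cone_params tau (params (slice (x 0))).
  by move/ZV/HV => [Tx [y Ly]]; split; last exact: Q_cone_params Ly.
have jetsE l s x : (0 < s <= tau)%N -> (jets x l)`_(tau - s) = (coords x l)`_s.
  by move=> s_in; rewrite coef_rev ifT; [congr (_`__)|]; lia.
case: (order_exists (Z e)) => [jets0|[v [o [v10 ot nz low]]]].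
  (* Here all jets vanish, so [h = 1] and the [tau + 6] base labels suffice; the surplus generators
     are the default label of [nth]. *)
  pose d := (8 * tau + 6)%N.
  have sd : (size base_labels <= d)%N by rewrite size_base_labels /d; lia.
  have hP : exists q : {mpoly k[d]}, forall x, Z e x ->
      1.@[x 0] = q.@[fun i : 'I_d => label_fun base_labels i x].
    by exists 1 => x _; rewrite !meval1.
  apply: (irreducible_chain_le chZ _ hP).
    by case: irrZ => -[x Zx] _ /(_ x Zx)/eqP; rewrite meval1 oner_eq0.
  apply: (localized_coordinates tau_gt0 hP Zcone) => [l s l10 s_in|l l_in|s s_in].
  - apply: localized_ext (localized_const _ _ _ 0) => x Zx.
    by rewrite -jetsE // jets0.
  - apply: (localized_label (c := (l, 0%N)) _ _ sd).
    by rewrite mem_cat (map_f (fun l => (l, 0%N))) ?orbT.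
  - apply: (localized_label (c := (10, s)%N) _ _ sd).
    by rewrite mem_cat (map_f (fun s => (10, s)%N)) // mem_iota; lia.
have sd := size_jet_labels v10 (ltnW ot).
have [h hE] := (polyfunP _).1 (polyfun_coords k tau v (tau - o)).
have vl : (v, (tau - o)%N) \in jet_labels v o.
  rewrite !mem_cat allpairs_f ?orbT //; last by rewrite mem_iota; lia.
  by rewrite mem_filter complement_irrefl // mem_iota.
have hP : exists q : {mpoly k[8 * tau + 6]}, forall x, Z e x ->
    h.@[x 0] = q.@[fun i : 'I_(8 * tau + 6) => label_fun (jet_labels v o) i x].
  have [i iE] := index_label sd vl; exists 'X_i => x _.
  by rewrite mevalXU iE -hE.
have hjet x : h.@[x 0] = (jets x v)`_o by rewrite -hE coef_rev ot.
apply: (irreducible_chain_le chZ _ hP).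
  by move=> h0; apply: nz => x Zx; rewrite -hjet h0.
have lab l s : (l, s) \in jet_labels v o -> localized (Z e) (fun x => h.@[x 0])
    (fun i : 'I_(8 * tau + 6) => label_fun (jet_labels v o) i) (fun x => (coords x l)`_s).
  by move=> ls; apply: (localized_label (c := (l, s)) _ _ sd).
have jet_lab l s : (o <= s < tau)%N -> (l, tau - s)%N \in jet_labels v o ->
    localized (Z e) (fun x => h.@[x 0])
    (fun i : 'I_(8 * tau + 6) => label_fun (jet_labels v o) i) (fun x => (jets x l)`_s).
  by move=> s_in /lab; apply: localized_ext => x _; rewrite -jetsE ?subKn //; lia.
apply: (localized_coordinates tau_gt0 hP Zcone) => [l s l10 s_in|l l_in|s s_in].
- apply: (localized_ext (f := fun x => (jets x l)`_(tau - s))).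
    by move=> x _; rewrite jetsE.
  apply: (localized_jets tau_gt0 hP Zcone v10 ot (fun x _ => hjet x) low) => //.
  + move=> l' s' l'10 l'N s'_in; apply: jet_lab => //.
    rewrite !mem_cat allpairs_f ?orbT //; last by rewrite mem_iota; lia.
    by rewrite mem_filter l'N mem_iota.
  + move=> c s' cC s'_in; have [s'o|os'] := ltnP s' o.
      apply: localized_ext (localized_const _ _ _ 0) => x Zx.
      by rewrite low // (complement_lt v10).
    apply: jet_lab; first by lia.
    by rewrite !mem_cat [X in _ || (_ || X)]allpairs_f ?orbT // mem_iota; lia.
- by apply: lab; rewrite !mem_cat (map_f (fun l => (l, 0%N))) ?orbT.
- by apply: lab; rewrite !mem_cat (map_f (fun s => (10, s)%N)) // mem_iota; lia.
Qed.

End ChainBoundMain.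

(** * The bound from below *)

Section GenericJets.
Variables (k : fieldType) (tau : nat).
Hypothesis tau_gt0 : (0 < tau)%N.
Local Notation n := (nunk tau).
Local Notation d := (8 * tau + 6)%N.
Implicit Types w : 'rV[k]_d.

(** Layout of the parameters: [tau] for [leading], 7 constant terms, [tau - 1] coefficients of c6
    from position [tau + 7] on, then six blocks of [tau] for the ratios from position [2 * tau + 6]
    on. *)
Definition entry w (i : nat) : k := if insub i is Some u then w 0 u else 0.

Lemma entry_ord w (u : 'I_d) : entry w u = w 0 u.
Proof. by rewrite /entry valK. Qed.

Definition leading w : {poly k} := \poly_(e < tau) entry w e.

(* Higher coefficients come first, so that the convolution with [leading] is
   triangular along the coordinate flag. *)
Definition ratio w (r : nat) : {poly k} :=
  \poly_(e < tau) entry w (2 * tau + 6 + r * tau + (tau.-1 - e)).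

(* Jets of the affine cone over Gr(2,5) in the chart where [b2] is invertible. *)
Definition generic_jets w (l : nat) : {poly k} :=
  leading w * nth 0
    [:: - (ratio w 2 * ratio w 4 + ratio w 0 * ratio w 1); ratio w 0; ratio w 1; 1;
        ratio w 4 * ratio w 5 - ratio w 0 * ratio w 3; ratio w 2; ratio w 3; ratio w 4;
        ratio w 5; - (ratio w 2 * ratio w 3 + ratio w 5 * ratio w 1)] l.

Definition constants w (l : nat) : k :=
  nth 0 [:: 0; entry w tau; 0; entry w (tau + 1); entry w (tau + 2); entry w (tau + 3);
         entry w (tau + 4); 0; entry w (tau + 5); entry w (tau + 6)] l.

Definition generic_coords w (l : nat) : {poly k} :=
  \poly_(s < tau.+1) if s == 0%N then constants w l else (generic_jets w l)`_(tau - s).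

(** Undoes the shift of a5, and takes both ends of c6 from -v so that v + c6 meets its two
    conditions. *)
Definition generic_params w (l : nat) : {poly k} :=
  if l == 7%N then \poly_(s < tau) (generic_coords w 7)`_s.+1
  else if l == 10%N then
    \poly_(s < tau.+1) if (0 < s < tau)%N then entry w (tau + 6 + s)
                       else - (generic_coords w 9)`_s
  else generic_coords w l.

Definition generic_point w : 'rV[k]_n := point_of tau (tangent_slice (generic_params w)).

Lemma shift7_generic w l : shift7 (generic_params w) l =
  if l == 10%N then generic_params w 10 else generic_coords w l.
Proof.
rewrite /shift7 /generic_params; case: eqP => [->|_]; last by case: eqP => // ->.
rewrite /=; apply/polyP => -[|s]; rewrite coefXM !coef_poly //= ltnS.
by case: (s < tau)%N.
Qed.

Lemma pluecker_generic w m : pluecker (generic_jets w) m = 0.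
Proof. by do 6?[case: m => [|m]] => //; rewrite /pluecker /generic_jets /=; ring. Qed.

Lemma agree_pluecker (q q' : nat -> {poly k}) e :
  (forall l i, (i <= e)%N -> (q l)`_i = (q' l)`_i) ->
  forall m, (pluecker q m)`_e = (pluecker q' m)`_e.
Proof.
move=> qq' m; have M l l' : (q l * q l')`_e = (q' l * q' l')`_e.
  by rewrite !coefM; apply: eq_bigr => i _; rewrite !qq' ?leq_subr // -ltnS ltn_ord.
by do 6?[case: m => [|m]]; rewrite /pluecker /= ?(coefD, coefN) ?M.
Qed.

Lemma size_pluecker (q : nat -> {poly k}) m : (forall l, (l < 10)%N -> (size (q l) <= tau.+1)%N) ->
  (size (pluecker q m) <= (2 * tau).+1)%N.
Proof.
move=> sq; have M l l' : (l < 10)%N -> (l' < 10)%N -> (size (q l * q l')%R <= (2 * tau).+1)%N.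
  by move=> l1 l2; apply: (leq_trans (size_mulr_leS (sq l l1) (sq l' l2))); lia.
do 6?[case: m => [|m]]; rewrite /pluecker /= ?size_poly0 //.
all: by repeat first [by apply: M | apply: size_subr_le | apply: size_addr_le].
Qed.

(** Coefficients of the quadrics above T^(2 tau) vanish for degree reasons. Those from [tau + 1] to
    [2 * tau] are, after reversal, coefficients below order [tau], where truncation does not disturb
    the exact relations of [generic_jets]. *)
Lemma generic_cone_params w : cone_params tau (generic_params w).
Proof.
have sc l : (size (generic_coords w l) <= tau.+1)%N by apply: size_poly.
have sp l : (size (generic_params w l) <= tau.+1)%N.
  by rewrite /generic_params; do 2?case: ifP => _ //; rewrite (leq_trans (size_poly _ _)).
have c9 s : (generic_params w 9 + generic_params w 10)`_s =
    if (0 < s < tau)%N then (generic_coords w 9)`_s + entry w (tau + 6 + s) else 0.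
  rewrite coefD /generic_params /= [X in _ + X]coef_poly.
  case: ltnP => [_|st]; first by case: ifP => //; rewrite subrr.
  by rewrite [X in X + _]coef_poly ltnNge st addr0; case: ifP => //; lia.
split=> [l _||||||m] //.
- exact: size_poly.
- by apply/leq_sizeP => s ts; rewrite c9; case: ifP => //; lia.
- by rewrite /generic_params /= coef_poly.
- by rewrite /generic_params /= coef_poly.
- have sl l : (l < 10)%N -> shift7 (generic_params w) l = generic_coords w l.
    by rewrite shift7_generic; case: eqP => // ->.
  have ssl l : (l < 10)%N -> (size (shift7 (generic_params w) l) <= tau.+1)%N.
    by move=> l10; rewrite sl.
  apply/leq_sizeP => s ts; have [s2|s2] := ltnP (2 * tau) s.
    by rewrite nth_default // (leq_trans (size_pluecker _ ssl)).
  rewrite -(subKn s2) -pluecker_rev //; last by lia.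
  rewrite -[RHS](coef0 k (2 * tau - s)) -(pluecker_generic w m).
  set e := (2 * tau - s)%N.
  (* [pluecker] reads only the ten indices below 10; elsewhere [q'] is set so that the agreement
     holds for all indices. *)
  pose q' l := if (l < 10)%N then rev_poly tau (shift7 (generic_params w) l) else generic_jets w l.
  transitivity (pluecker q' m)`_e.
    by do 6?[case: m => [|m]]; rewrite /pluecker.
  apply: agree_pluecker => l i ie; rewrite /q'; case: ifP => // l10.
  have it : (i < tau)%N by lia.
  rewrite coef_rev it sl // coef_poly ifT; last by lia.
  by rewrite ifF; [congr (_`__)|apply/negbTE]; lia.
Qed.

Lemma coords_generic w l : (l <= 10)%N ->
  coords (generic_point w) l = if l == 10%N then generic_params w 10 else generic_coords w l.
Proof.
move=> l10; rewrite -shift7_generic /coords /shift7.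
have S := slice_point_of (tangent_supported tau_gt0 (generic_cone_params w)).
have -> : params (slice (generic_point w 0)) l = params (tangent_slice (generic_params w)) l.
  by rewrite /params /generic_point !S.
suff -> : params (tangent_slice (generic_params w)) l = generic_params w l by [].
move: (generic_params w) => p; do 11?[case: l l10 => [|l] l10 //]; rewrite /params /=; ring.
Qed.

Lemma polyfun_entry i : polyfun (fun w => entry w i).
Proof.
rewrite /entry; case: insub => [u|]; first exact: localized_gen.
exact: localized_const.
Qed.

Lemma polyfun_generic u : polyfun (fun w => generic_point w 0 u).
Proof.
pose pf P := localized_poly (fun _ : 'rV[k]_d => True) (fun=> 1) (fun i x => x 0 i) P.
have hP := @polyfun1 k d.
have lead : pf leading by apply: localized_poly_coefs => s _; apply: polyfun_entry.
have rat r : pf (ratio^~ r) by apply: localized_poly_coefs => s _; apply: polyfun_entry.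
have one : pf (fun=> 1) by move=> s; apply: localized_const.
have jet l : pf (generic_jets^~ l).
  apply: (localized_polyM hP lead); do 10?[case: l => [|l]]; rewrite /= ?nth_nil;
  repeat first [exact: rat | exact: one | exact: localized_poly0 | apply: (localized_polyB hP)
    | apply: localized_polyN | apply: (localized_polyD hP) | apply: (localized_polyM hP)].
have cst l : polyfun (fun w => constants w l).
  do 10?[case: l => [|l]]; rewrite /constants /= ?nth_nil;
    first [exact: polyfun_entry | exact: localized_const].
have crd l : pf (generic_coords^~ l).
  by apply: localized_poly_coefs => s _; case: eqP => _; [apply: cst|apply: jet].
have par l : pf (generic_params^~ l).
  rewrite /generic_params; case: eqP => _.
    by apply: localized_poly_coefs => s _; apply: crd.
  case: eqP => _; last exact: crd.
  apply: localized_poly_coefs => s _; case: (0 < s < tau)%N; first exact: polyfun_entry.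
  exact: (localizedN (crd 9%N s)).
case uE : (unk u) => [[a i] r].
have := localized_tangent hP a i (r.-1 %% 6).+1%N (fun l _ => par l) (r.-1 %/ 6)%N.
by apply: localized_ext => w _; rewrite /generic_point mxE uE.
Qed.

(* The coefficient of [coords] that detects the [i]-th parameter. *)
Definition detector (i : nat) : nat * nat :=
  (if i < tau then (3, tau - i)
   else if i < tau + 7 then (nth 0 [:: 1; 3; 4; 5; 6; 8; 9] (i - tau), 0)
   else if i < 2 * tau + 6 then (10, i - tau - 6)
   else (nth 0 [:: 1; 2; 5; 6; 7; 8] ((i - (2 * tau + 6)) %/ tau),
         ((i - (2 * tau + 6)) %% tau).+1))%N.

Lemma detector_linear w (i : 'I_d) : (i < 2 * tau + 6)%N ->
  (coords (generic_point w) (detector i).1)`_(detector i).2 = w 0 i.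
Proof.
move=> i_lt; rewrite -entry_ord /detector; case: ltnP => [it|ti].
  rewrite coords_generic //= coef_poly ifT ?ifF; [|lia|lia].
  by rewrite /generic_jets /= mulr1 subKn ?coef_poly ?it // ltnW.
case: ltnP => [i7|i7].
  set j := (i - tau)%N; have -> : (i : nat) = (tau + j)%N by rewrite subnKC.
  have j7 : (j < 7)%N by lia.
  rewrite coords_generic /=; last by do 7?[case: j j7 => [//|j] j7].
  do 7?[case: j j7 => [|j] j7 //]; by rewrite coef_poly /= ?addn0.
rewrite i_lt coords_generic //= coef_poly ifT; last by lia.
by rewrite ifT; [congr entry|]; lia.
Qed.

Lemma detector_ratio w (i : 'I_d) : (2 * tau + 6 <= i)%N ->
  exists r e, [/\ (e < tau)%N, (i : nat) = (2 * tau + 6 + r * tau + (tau.-1 - e))%N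
    & (coords (generic_point w) (detector i).1)`_(detector i).2 = (leading w * ratio w r)`_e].
Proof.
move=> i_ge; set j := (i - (2 * tau + 6))%N.
have j_lt : (j < 6 * tau)%N by have := ltn_ord i; lia.
have jm := ltn_pmod j tau_gt0; have jE := divn_eq j tau.
have r6 : (j %/ tau < 6)%N by rewrite ltn_divLR.
exists (j %/ tau)%N, (tau.-1 - j %% tau)%N; split; [lia|rewrite subKn; lia|].
rewrite /detector !ifF; [|lia|lia|lia]; rewrite -/j /=.
have -> : (tau.-1 - j %% tau)%N = (tau - (j %% tau).+1)%N by lia.
case: (j %/ tau)%N r6 => [|[|[|[|[|[|//]]]]]] _; by rewrite coords_generic //= coef_poly ltnS jm.
Qed.

End GenericJets.

Lemma second_order_chain (k : closedFieldType) tau (V : affine_set k (nunk tau)) :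
  (0 < tau)%N -> zclosed V ->
  (forall x, T_H x -> (exists y : 'rV[k]_(nunk tau), forall e, lin (y 0) e = quad (x 0) e) ->
     V x) ->
  exists Z, irreducible_chain V (8 * tau + 6) Z.
Proof.
move=> tau_gt0 Vcl HV.
pose c (i : 'I_(8 * tau + 6)) (x : 'rV[k]_(nunk tau)) :=
  (coords x (detector tau i).1)`_(detector tau i).2.
exists (flag_image (@generic_point k tau)).
apply: (flag_chain (c := c)) => //.
- exact: polyfun_generic.
- by move=> i; apply: polyfun_coords.
- by move=> w; have [] := cone_point tau_gt0 (generic_cone_params tau_gt0 w); apply: HV.
- move=> i w fw; rewrite /c; have [i_lt|i_ge] := ltnP i (2 * tau + 6).
    by rewrite detector_linear // fw.
  have [r [e [et iE ->]]] := detector_ratio tau_gt0 w i_ge.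
  (* Only ratio coefficients of index at most [e] enter; in the reversed layout they sit at
     positions from [i] on, where the flag imposes zero. *)
  rewrite coefM big1 // => l _; rewrite [X in _ * X]coef_poly; case: ifP => [lt|_].
    rewrite /entry; case: insubP => [u _ uE|_]; last by rewrite mulr0.
    rewrite fw ?mulr0 // uE iE; lia.
  by rewrite mulr0.
- move=> i; have [i_lt|i_ge] := ltnP i (2 * tau + 6).
    exists (delta_mx 0 i); last by rewrite /c detector_linear // mxE !eqxx oner_neq0.
    move=> l il; rewrite mxE (_ : l == i = false) ?andbF //.
    by apply/eqP => li; rewrite li ltnn in il.
  have d_gt0 : (0 < 8 * tau + 6)%N by lia.
  (* The first basis vector turns [leading] into 1, so that the product is the ratio itself and the
     second one shows up undisturbed. *)
  pose w : 'rV[k]_(8 * tau + 6) := delta_mx 0 (Ordinal d_gt0) + delta_mx 0 i.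
  have wE j : entry w j = (j == 0%N)%:R + (j == i)%:R.
    rewrite /entry; case: insubP => [u _ <-|].
      by rewrite !mxE /= -!val_eqE.
    rewrite -leqNgt => j_ge; have := ltn_ord i => i_lt.
    have [-> ->] : (j == 0%N) = false /\ (j == i) = false by lia.
    by rewrite addr0.
  exists w => [l il|].
    rewrite -entry_ord wE.
    have [-> ->] : ((l : nat) == 0%N) = false /\ ((l : nat) == i) = false by lia.
    by rewrite addr0.
  have [r [e [et iE cE]]] := detector_ratio tau_gt0 w i_ge; rewrite /c cE.
  have -> : leading w = 1.
    apply/polyP => s; rewrite coef_poly coef1 wE; case: ltnP => [st|ts].
      by rewrite (_ : (s == i) = false) ?addr0 //; lia.
    by rewrite (_ : (s == 0%N) = false) //; lia.
  rewrite mul1r coef_poly et -iE wE eqxx (_ : ((i : nat) == 0%N) = false); last by lia.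
  by rewrite add0r oner_neq0.
Qed.

Theorem corollary4p5 (k : closedFieldType) (char2 : 2%N \notin [pchar k])
    (char3 : 3%N \notin [pchar k]) (tau : nat) (tau_gt0 : (0 < tau)%N) :
  (exists E B s, @is_elimination k tau E B s) /\
  (forall E B s, @is_elimination k tau E B s ->
     has_dim (@Q_H k tau s) (8 * tau + 6)).
Proof.
split=> [|E B s elim]; first exact: elimination_exists.
split.
  apply: second_order_chain => // [|x Tx y]; last by apply/(Q_H_second_order _ elim).
  exists (fun p => exists j, p = pihomog mdeg 1 (rho k tau j) \/
                            p = pihomog mdeg 2 (rho k tau j \mPo s)) => x.
  split=> [[Tx Qx] p [j [->|->]] //|zx].
  by split=> j; apply: zx; exists j; [left|right].
move=> e Z; apply: second_order_chain_le => // x Qx.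
exact/(Q_H_second_order _ elim).
Qed.
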